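(* Let $n\ge 2$, $\mu\ge 2$, let $f=(f_1,\dots,f_n):\mathbb{C}^n\to\mathbb{C}^n$ be a polynomial system, and let $x\in\mathbb{C}^n$ be a simple multiple zero of $f$ of multiplicity $\mu$ such that $Df(x)$ has the normalized form. If $y\neq x$ is another zero of $f$, then $$\|y-x\|\ \ge\ \frac{d}{2\gamma_\mu^{\mu}},$$ where $\gamma_\mu=\gamma_\mu(f,x)$ and $d=d(\mu)>0$ is the constant, depending only on $\mu$, defined in the context.
   Context: Notation. $X=(X_1,\dots,X_n)$, $\hat X=(X_2,\dots,X_n)$, $\hat f=(f_1,\dots,f_{n-1})$. $Df(x)$ is the $n\times n$ Jacobian matrix; $D\hat f(x)$ is the $(n-1)\times(n-1)$ Jacobian of $\hat f$ with respect to $\hat X$ only. For $k\ge2$, $D^k\hat f(x)$ and $D^kf_n(x)$ are the $k$-th derivatives with respect to all variables $X_1,\dots,X_n$, regarded as symmetric $k$-linear maps. $\|\cdot\|$ is the Hermitian norm on vectors and the operator norm on matrices and multilinear maps. Differential functionals. At the point $x$ put $d_1^{\alpha_1}\cdots d_n^{\alpha_n}(h)=\frac{1}{\alpha_1!\cdots\alpha_n!}\frac{\partial^{|\alpha|}h}{\partial X_1^{\alpha_1}\cdots\partial X_n^{\alpha_n}}(x)$. Let $\Psi_\sigma$ be the linear operator with $\Psi_\sigma(d_1^{\alpha_1}\cdots d_n^{\alpha_n})=d_\sigma^{\alpha_\sigma+1}d_{\sigma+1}^{\alpha_{\sigma+1}}\cdots d_n^{\alpha_n}$ if $\alpha_1=\dots=\alpha_{\sigma-1}=0$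 and $0$ otherwise. When $D\hat f(x)$ is invertible, set $a_{1,1}=1$, $a_{1,\sigma}=0$ for $\sigma\ge2$, $\Lambda_1=d_1$, $a_{k,1}=0$ for $k\ge2$, and inductively for $k\ge 2$ $$\Delta_k=\sum_{\sigma=1}^n\Psi_\sigma(a_{1,\sigma}\Lambda_{k-1}+\cdots+a_{k-1,\sigma}\Lambda_1),\qquad \Lambda_k=\Delta_k+\sum_{\sigma=2}^n a_{k,\sigma}d_\sigma,$$ $$(a_{k,2},\dots,a_{k,n})^T=-D\hat f(x)^{-1}(\Delta_k(f_1),\dots,\Delta_k(f_{n-1}))^T.$$ Normalized form and simple multiple zeros. $Df(x)$ has the normalized form if $Df(x)=\begin{pmatrix}0&D\hat f(x)\\0&0\end{pmatrix}$ (first column and last row zero) with $D\hat f(x)$ invertible. In that case $x$ is a simple multiple zero of $f$ of multiplicity $\mu$ if $f(x)=0$, $\Delta_k(f_n)=0$ for $2\le k\le\mu-1$, and $\Delta_\mu(f_n)\ne0$. The quantity $\gamma_\mu$. $\gamma_\mu(f,x)=\max(\hat\gamma_\mu(f,x),\gamma_{\mu,n}(f,x))$ with $$\hat\gamma_\mu(f,x)=\max\Big(1,\sup_{k\ge2}\Big\|D\hat f(x)^{-1}\tfrac{D^k\hat f(x)}{k!}\Big\|^{\frac1{k-1}}\Big),\quad \gamma_{\mu,n}(f,x)=\max\Big(1,\sup_{k\ge2}\Big\|\tfrac{1}{\Delta_\mu(f_n)}\tfrac{D^kf_n(x)}{k!}\Big\|^{\frac1{k-1}}\Big).$$ The constant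 $d$. Define positive numbers $c_{i,j}$ ($i\ge0$, $j\ge1$, $2\le i+j\le\mu$) recursively on $i+j$ by $$c_{i,j}=\binom{i+j}{j}+\sum c_{i',j'}\binom{i+j-i'-j'+1}{i-i'},$$ the sum being over $(i',j')$ with $j'\ge1$, $0\le i'\le i$, $j'-1\le j$, $2\le i'+j'<i+j$; and set $t_{i,j}=c_{i,j+1}$ for $i,j\ge0$, $1\le i+j\le\mu-2$. (For $\mu=2$: $c_{1,1}=2,c_{0,2}=1$; for $\mu=3$: $c_{2,1}=8,c_{1,2}=7,c_{0,3}=2,t_{1,0}=2,t_{0,1}=1$.) Let $d=\min(d_1,d_2,d_3)$ with $d_1=\sqrt{\frac{1}{c_{\mu-1,1}^2+1}}$, $d_2=\sqrt{\frac1{\mu-1}}$, and $d_3$ the smallest positive real root of $$p(d)=(1-d^2)^{\frac\mu2}-\sum_{i+j=\mu,\,j>0}c_{i,j}\,d\,(1-d^2)^{\frac i2}d^{j-1}-d\Big(\sum_{1\le i\le\mu-2}t_{i,0}+\sum_{1\le i+j\le\mu-2,\,j>0}t_{i,j}(1-d^2)^{\frac i2}d^j+1\Big).$$ *)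

(* Defs.v *)
From HB Require Import structures.
From mathcomp Require Import all_boot all_order all_algebra.
From mathcomp Require Import mpoly complex.
From mathcomp Require Import boolp classical_sets reals exp.

Set Implicit Arguments.
Unset Strict Implicit.
Unset Printing Implicit Defensive.

Import Order.TTheory GRing.Theory Num.Theory.
Local Open Scope ring_scope.

(* C is R[i] for a realType R.  The ambient dimension is n.+1 throughout, so  *)
(* that X_1 has index ord0 and f_n has index ord_max.                         *)

Section Systems.
Variables (R : realType) (n : nat).
Local Notation C := R[i].
Local Notation poly := {mpoly C[n.+1]}.
Local Notation point := 'cV[C]_n.+1.

Definition system (p : nat) := 'I_p -> poly.

Definition evalp (h : poly) (x : point) : C := h.@[fun i => x i 0].

Definition is_zero (f : system n.+1) (x : point) : Prop :=
  forall i, evalp (f i) x = 0.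

Definition jacobian p (g : system p) (x : point) : 'M[C]_(p, n.+1) :=
  \matrix_(i, j) evalp ((g i)^`M(j)) x.

(* (f_1, ..., f_{n-1}) and f_n, the latter as a system of one polynomial. *)
Definition hatf (f : system n.+1) : system n := fun i => f (lift ord_max i).
Definition lastf (f : system n.+1) : system 1 := fun=> f ord_max.

Definition Dhat (f : system n.+1) (x : point) : 'M[C]_n :=
  \matrix_(i, j) jacobian (hatf f) x i (lift ord0 j).

Definition normalized_form (f : system n.+1) (x : point) : Prop :=
  [/\ forall i, jacobian f x i ord0 = 0,
      forall j, jacobian f x ord_max j = 0
    & Dhat f x \in unitmx].

(* The functional d_1^{a_1} ... d_n^{a_n} at x is encoded by the monomial     *)
(* 'X_[a], so that a finite combination of such functionals is a polynomial   *)
(* in the indeterminates d_1, ..., d_n.                                       *)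
Definition functional := poly.

Definition apply_functional (L : functional) (x : point) (h : poly) : C :=
  \sum_(a <- msupp L)
    L@_a * (evalp (h^`M[a]) x / (\prod_(i < n.+1) (a i)`!)%:R).

Definition Psi (s : 'I_n.+1) (L : functional) : functional :=
  \sum_(a <- msupp L | [forall t : 'I_n.+1, (t < s)%N ==> (a t == 0%N)])
    L@_a *: 'X_[a + U_(s)].

(* The entry of index k - 1 of a dual sequence is the pair                    *)
(* ((a_{k,1}, ..., a_{k,n})^T, Lambda_k); the recursions it satisfies are     *)
(* stated by DeltaE, coefaE and LambdaE below.                                *)
Definition dual_seq := seq (point * functional).

Definition next_Delta (l : dual_seq) : functional :=
  \sum_(s < n.+1)
    Psi s (\sum_(j < size l)
             (nth (0, 0) l j).1 s 0 *: (nth (0, 0) l (size l - j.+1)).2).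

Definition next_a (f : system n.+1) (x : point) (l : dual_seq) : point :=
  col_mx (0 : 'cV[C]_1)
    (- (invmx (Dhat f x)
        *m (\col_i apply_functional (next_Delta l) x (hatf f i)))).

Definition next_Lambda (f : system n.+1) (x : point) (l : dual_seq) :
    functional :=
  next_Delta l + \sum_(s < n.+1 | s != ord0) next_a f x l s 0 *: 'X_s.

Fixpoint duals (f : system n.+1) (x : point) (k : nat) : dual_seq :=
  match k with
  | 0 => [::]
  | k'.+1 =>
    if k' is 0 then [:: (delta_mx ord0 0, 'X_ord0)] else
    rcons (duals f x k')
      (next_a f x (duals f x k'), next_Lambda f x (duals f x k'))
  end.

(* Meaningful for k >= 1 (coefa, Lambda) and k >= 2 (Delta). *)
Definition coefa f x (k : nat) : point := (nth (0, 0) (duals f x k) k.-1).1.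
Definition Lambda f x (k : nat) : functional :=
  (nth (0, 0) (duals f x k) k.-1).2.
Definition Delta f x (k : nat) : functional := next_Delta (duals f x k.-1).

Definition simple_multiple_zero (f : system n.+1) (x : point) (mu : nat) :
    Prop :=
  [/\ is_zero f x,
      forall k, (2 <= k <= mu.-1)%N ->
        apply_functional (Delta f x k) x (f ord_max) = 0
    & apply_functional (Delta f x mu) x (f ord_max) != 0].

Definition hnorm p (v : 'cV[C]_p) : R :=
  Num.sqrt (\sum_i Normc.normc (v i 0) ^+ 2).

(* Operator norm of a map that is meant to be k-linear. *)
Definition opnorm k p (F : ('I_k -> point) -> 'cV[C]_p) : R :=
  sup [set hnorm (F v) | v in [set v | forall i, hnorm (v i) <= 1]]%classic.

(* D^k g(x), as a symmetric k-linear map. *)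
Definition Dk p (g : system p) (x : point) k (v : 'I_k -> point) : 'cV[C]_p :=
  \col_i \sum_(j : {ffun 'I_k -> 'I_n.+1})
    evalp ((g i)^`M[(\sum_(l < k) U_(j l))%MM]) x * \prod_(l < k) v l (j l) 0.

Definition hatgamma (f : system n.+1) (x : point) : R :=
  Num.max 1 (sup [set opnorm (fun v : 'I_k -> point =>
                         invmx (Dhat f x) *m ((k`!)%:R^-1 *: Dk (hatf f) x v))
                       `^ (k.-1%:R^-1) | k in [set k : nat | (2 <= k)%N]])%classic.

Definition lastgamma (f : system n.+1) (x : point) (mu : nat) : R :=
  Num.max 1 (sup [set opnorm (fun v : 'I_k -> point =>
                         (apply_functional (Delta f x mu) x (f ord_max))^-1
                           *: ((k`!)%:R^-1 *: Dk (lastf f) x v))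
                       `^ (k.-1%:R^-1) | k in [set k : nat | (2 <= k)%N]])%classic.

Definition gamma (f : system n.+1) (x : point) (mu : nat) : R :=
  Num.max (hatgamma f x) (lastgamma f x mu).

Lemma dualsS f x k : duals f x k.+2 =
  rcons (duals f x k.+1)
    (next_a f x (duals f x k.+1), next_Lambda f x (duals f x k.+1)).
Proof. by []. Qed.

Lemma size_duals f x k : size (duals f x k) = k.
Proof. by elim: k => [|[|k] IH] //; rewrite dualsS size_rcons IH. Qed.

Lemma nth_duals f x k j : (j < k)%N ->
  nth (0, 0) (duals f x k) j = (coefa f x j.+1, Lambda f x j.+1).
Proof.
rewrite /coefa /Lambda -surjective_pairing /=.
elim: k => // k IH; rewrite ltnS leq_eqVlt => /predU1P[-> //|jk].
rewrite -IH //; case: k jk {IH} => // k jk.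
by rewrite dualsS nth_rcons size_duals jk.
Qed.

Lemma coefa1 f x : coefa f x 1 = delta_mx ord0 0.
Proof. by []. Qed.

Lemma Lambda1 f x : Lambda f x 1 = 'X_ord0.
Proof. by []. Qed.

Lemma DeltaE f x k : (2 <= k)%N ->
  Delta f x k = \sum_(s < n.+1)
    Psi s (\sum_(1 <= j < k) coefa f x j s 0 *: Lambda f x (k - j)).
Proof.
case: k => [|[|k]] // _; rewrite /Delta /next_Delta size_duals.
apply: eq_bigr => s _; congr Psi; rewrite big_add1 big_mkord.
apply: eq_bigr => j _; rewrite !nth_duals //= ?subSS ?ltnS ?leq_subr //.
by rewrite subSn // -ltnS.
Qed.

Lemma coefaE f x k : (2 <= k)%N ->
  coefa f x k = col_mx (0 : 'cV[C]_1)
    (- (invmx (Dhat f x)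
        *m (\col_i apply_functional (Delta f x k) x (hatf f i)))).
Proof.
case: k => [|[|k]] // _; rewrite /coefa dualsS.
by rewrite nth_rcons size_duals ltnn eqxx.
Qed.

Lemma LambdaE f x k : (2 <= k)%N ->
  Lambda f x k =
    Delta f x k + \sum_(s < n.+1 | s != ord0) coefa f x k s 0 *: 'X_s.
Proof.
case: k => [|[|k]] // _; rewrite /Lambda /coefa dualsS.
by rewrite nth_rcons size_duals ltnn eqxx.
Qed.

End Systems.

Section Constant.

(* The first argument bounds the depth of the recursion on i + j; see c_coefE *)
(* for the recursion proper.                                                  *)
Fixpoint c_rec (s i j : nat) : nat :=
  if s is s'.+1 then
    ('C(i + j, j) +
     \sum_(i' < i.+1)
       \sum_(j' < j.+2 | (0 < j') && (2 <= i' + j' < i + j))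
         c_rec s' i' j' * 'C((i + j - (i' + j')).+1, i - i'))%N
  else 0%N.

Definition c_coef (i j : nat) : nat := c_rec (i + j) i j.
Definition t_coef (i j : nat) : nat := c_coef i j.+1.

Lemma c_rec_stable s i j : (0 < j)%N -> (i + j <= s)%N -> c_rec s i j = c_coef i j.
Proof.
elim/ltn_ind: s i j => s IH i j j0 ijs; rewrite /c_coef.
case: s IH ijs => [|s IH ijs]; first by rewrite leqn0 addn_eq0 (gtn_eqF j0) andbF.
have: (0 < i + j)%N by rewrite addn_gt0 j0 orbT.
move=> ij0; rewrite -(prednK ij0) /=; congr addn.
apply: eq_bigr => i' _; apply: eq_bigr => j' /and3P[j'0 _ lt].
rewrite IH //; last by rewrite -ltnS (leq_trans lt).
rewrite IH //; last by rewrite -ltnS prednK.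
by rewrite prednK.
Qed.

Lemma c_coefE i j : (0 < j)%N ->
  c_coef i j =
    ('C(i + j, j) +
     \sum_(i' < i.+1)
       \sum_(j' < j.+2 | (0 < j') && (2 <= i' + j' < i + j))
         c_coef i' j' * 'C((i + j - (i' + j')).+1, i - i'))%N.
Proof.
move=> j0; have ij0 : (0 < i + j)%N by rewrite addn_gt0 j0 orbT.
rewrite {1}/c_coef -{1}(prednK ij0) /=; congr addn.
apply: eq_bigr => i' _; apply: eq_bigr => j' /and3P[j'0 _ lt].
by rewrite c_rec_stable // -ltnS prednK.
Qed.

Variable R : realType.

Definition pd (mu : nat) (d : R) : R :=
  let q := Num.sqrt (1 - d ^+ 2) in
  q ^+ mu
  - \sum_(1 <= j < mu.+1) (c_coef (mu - j) j)%:R * d * q ^+ (mu - j) * d ^+ j.-1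
  - d * (\sum_(1 <= i < mu.-1) (t_coef i 0)%:R
         + \sum_(0 <= i < mu.-1) \sum_(1 <= j < mu.-1 | (i + j <= mu - 2)%N)
             (t_coef i j)%:R * q ^+ i * d ^+ j
         + 1).

(* [pd mu r] is the intended real expression only for r ^+ 2 <= 1. *)
Definition pos_root (mu : nat) (r : R) : Prop := 0 < r <= 1 /\ pd mu r = 0.

Definition d1 (mu : nat) : R := Num.sqrt (1 / ((c_coef mu.-1 1)%:R ^+ 2 + 1)).
Definition d2 (mu : nat) : R := Num.sqrt (1 / mu.-1%:R).
(* The smallest root (0 if there were none). *)
Definition d3 (mu : nat) : R :=
  xget 0 [set r | pos_root mu r /\ forall s, pos_root mu s -> r <= s]%classic.

Definition dconst (mu : nat) : R := Num.min (d1 mu) (Num.min (d2 mu) (d3 mu)).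

End Constant.

(* Main.v *)
Require Import Defs.
From mathcomp Require Import all_boot all_order all_algebra.
From mathcomp Require Import ssrcomplements mpoly complex.
From mathcomp Require Import boolp classical_sets reals exp.
From mathcomp Require Import topology normedtype realfun.
From mathcomp Require Import zify ring lra.
Import Order.TTheory GRing.Theory Num.Theory numFieldNormedType.Exports.
Local Open Scope ring_scope.

(** Let w = y - x, s = |w|, t its first coordinate, v = w - t e_1, and let g be
    gamma_mu.  Put A_k = Dhat(x)^-1 D^k hatf(x) / k! and
    B_k = D^k f_n(x) / (k! Delta_mu(f_n)); for k >= 2 both have norm at most
    g^(k-1) ([hat_form_bound], [last_form_bound]).  In normalized form the
    Taylor formula at the zero y reads v = - sum_(k >= 2) A_k(w^k) and
    0 = sum_(k >= 2) B_k(w^k).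

    The first equation gives |v| <= 2 g s^2 as soon as g s <= 1/2, so a zero near
    x lies almost on the first axis.  The second one is expanded into monomials
    t^i v^j.  A monomial with j > 0 and i + j < mu has too small a degree;
    replacing one of its factors v by - sum_k A_k(w^k) raises its degree.
    Doing so in the order of increasing degrees leaves j-linear forms T_(i,j)
    ([elim_form], [elimination]).  The numbers c_(i,j) count the binomials
    met on the way, whence |T_(i,j)| <= c_(i,j) g^(i+j-1)
    ([elim_form_bound]), and the Taylor remainders neglected at each
    substitution, one for every t_(i,j), are O(g^mu s^(mu+1)).

    The forms T_(i,0) do not depend on y.  They are found by evaluating the same
    identity along the curve sum_(k < mu) a_k t^k, whose coefficients are those
    computed by the dual sequence; Lambda_k(h) and Delta_k(h) are
    coefficients of h along it ([curve_expansion]).  On this curve hatf is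
    O(t^mu) and f_n is Delta_mu(f_n) t^mu + O(t^(mu+1)); letting t tend to 0,
    T_(k,0) = 0 for k < mu and T_(mu,0) = 1 ([elim_form_on_axis]).

    What remains ([eliminated_bound]) bounds |t|^mu by the terms of degree mu
    with j > 0 and by the remainders.  Divide by s^mu: with the cosine |t|/s and
    the sine |v|/s of the angle between w and the first axis, and
    delta = 2 g^mu s, the sine is at most delta / g^(mu-1).  If delta < d, the
    bounds d <= d_1, d_2 allow replacing the sine by d in each monomial, and the
    inequality becomes p(d) < 0 ([angular_inequality]), whereas p >= 0 up to
    its smallest positive root d_3 >= d.  This root exists and d is positive
    because p(0) = 1 and p(1) < 0 ([smallest_root]). *)

Set Implicit Arguments.
Unset Strict Implicit.
Unset Printing Implicit Defensive.

(** * Elimination of the low-order monomials *)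

Lemma prod_nseq (S : comNzRingType) (I : Type) k (u : I) (F : I -> S) :
  \prod_(v <- nseq k u) F v = F u ^+ k.
Proof. by rewrite big_nseq; elim: k => //= k ->; rewrite exprS. Qed.

Lemma sum_ord_change (M : nmodType) n N (P Q : pred nat) (F : nat -> M) :
  (forall i, (i < n)%N && P i = (i < N)%N && Q i) ->
  \sum_(i < n | P i) F i = \sum_(i < N | Q i) F i.
Proof.
move=> PQ; rewrite (big_ord_widen_cond _ _ _ (leq_maxl n N)).
rewrite (big_ord_widen_cond _ _ _ (leq_maxr n N)).
by apply: eq_bigl => i; rewrite andbC PQ andbC.
Qed.

(** Collects, in the total degree k, what each eliminated monomial (i', j')
    receives: the substituted form of degree k - (i' + j') + 1 spreads over the
    monomials (i' + r, k - i' - r).  The right-hand side uses j'.-1 as index, which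
    is the number of factors left after the substitution. *)
Lemma elim_sum_exchange (M : nmodType) k (G : nat -> nat -> nat -> M) :
  \sum_(i < k.+1) \sum_(i' < i.+1)
    \sum_(j' < (k - i).+2 | (0 < j')%N && (2 <= i' + j' < k)%N) G i i' j' =
  \sum_(i' < k) \sum_(j' < k | (0 < i' + j' < k.-1)%N)
    \sum_(r < (k - (i' + j')).+1) G (i' + r)%N i' j'.+1.
Proof.
(* Both sides extended by 0 to the same box of indices. *)
pose H i i' j' := if [&& i' <= i, i + j' <= k & 0 < i' + j' < k.-1]%N
  then G i i' j'.+1 else 0.
transitivity (\sum_(i < k.+1) \sum_(i' < k) \sum_(j' < k) H i i' j').
  apply: eq_bigr => i _.
  transitivity (\sum_(i' < k | (i' <= i)%N) \sum_(j' < k) H i i' j'); last first.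
    rewrite big_mkcond; apply: eq_bigr => i' _; case: ifP => // i'i.
    by rewrite big1 // => j' _; rewrite /H i'i.
  transitivity (\sum_(i' < i.+1 | (i' < k)%N) \sum_(j' < k) H i i' j').
    rewrite [RHS]big_mkcond; apply: eq_bigr => i' _.
    rewrite big_mkcond big_ord_recl /= add0r.
    case: ifP => i'k; last by rewrite big1 // => j' _; case: ifP => //; lia.
    rewrite -big_mkcond /=.
    rewrite (sum_ord_change (N := k) (P := fun j => (1 < i' + j.+1 < k)%N)
      (Q := fun j => [&& i' <= i, i + j <= k & 0 < i' + j < k.-1]%N)
      (fun j => G i i' j.+1)); first by rewrite big_mkcond.
    by move=> j; have := ltn_ord i; have := ltn_ord i'; lia.
  apply: (sum_ord_change (P := fun i' => (i' < k)%N)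
      (Q := fun i' => (i' <= i)%N) (fun i' => \sum_(j' < k) H i i' j')) => j.
  by lia.
rewrite exchange_big; apply: eq_bigr => i' _.
rewrite exchange_big [RHS]big_mkcond; apply: eq_bigr => j' _.
case: ifP => cond; last by rewrite big1 // => i _; rewrite /H cond !andbF.
rewrite -(big_mkord xpredT (fun r => G (i' + r)%N i' j'.+1)).
rewrite [RHS](eq_bigr (fun r => G (r + i')%N i' j'.+1)); last first.
  by move=> r _; rewrite addnC.
rewrite -[(k - (i' + j')).+1](addKn i') -(big_addn 0%N (i' + (k - (i' + j')).+1) i' xpredT (fun i => G i i' j'.+1)).
rewrite (big_nat_widen _ _ k.+1); last by lia.
rewrite (big_nat_widenl _ 0%N) // big_mkord.
rewrite [RHS]big_mkcond; apply: eq_bigr => i _; rewrite /H cond.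
by do 2?[case: ifP] => //; lia.
Qed.

Lemma sum_antidiagonals (M : nmodType) mu (F : nat -> nat -> M) :
  \sum_(2 <= k < mu) \sum_(i < k) F i (k - i)%N =
  \sum_(i < mu) \sum_(j < mu | (0 < i + j < mu.-1)%N) F i j.+1.
Proof.
transitivity (\sum_(2 <= k < mu) \sum_(i < mu | (i < k)%N) F i (k - i)%N).
  apply: eq_big_nat => k /andP[k2 kmu].
  by rewrite (big_ord_widen _ (fun i => F i (k - i)%N) (ltnW kmu)).
rewrite (exchange_big_dep xpredT) //=; apply: eq_bigr => i _.
rewrite (big_nat_widenl _ 0%N) // big_mkord.
rewrite (sum_ord_change (N := mu) (P := fun k => (i < k)%N && (1 < k)%N)
  (Q := fun k => (1 < k)%N && (i.+1 <= k)%N) (fun k => F i (k - i)%N)); last by lia.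
rewrite -(big_mkord (fun k => (1 < k)%N && (i.+1 <= k)%N) (fun k => F i (k - i)%N)).
rewrite -(big_nat_widenl _ 0%N) // -{1}(add0n i.+1) big_addn big_mkord.
rewrite (eq_bigr (fun j : 'I_(mu - i.+1) => F i j.+1)); last first.
  by move=> j _; congr F; lia.
apply: (sum_ord_change (P := fun j => (1 < j + i.+1)%N)
  (Q := fun j => (0 < i + j < mu.-1)%N) (fun j => F i j.+1)) => j.
by lia.
Qed.

Lemma sum_shifted_order (M : nmodType) mu (H : nat -> nat -> nat -> M) :
  \sum_(2 <= k < mu.+1) \sum_(i < k) \sum_(j < k | (0 < i + j < k.-1)%N)
    H i j (k - (i + j))%N =
  \sum_(i < mu) \sum_(j < mu | (0 < i + j < mu.-1)%N)
    \sum_(2 <= m < (mu - (i + j)).+1) H i j m.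
Proof.
transitivity (\sum_(2 <= k < mu.+1) \sum_(i < mu) \sum_(j < mu)
    if (0 < i + j < k.-1)%N then H i j (k - (i + j))%N else 0).
  apply: eq_big_nat => k /andP[k2 kmu].
  rewrite (big_ord_widen _ (fun i => \sum_(j < k | (0 < i + j < k.-1)%N)
    H i j (k - (i + j))%N) (kmu : (k <= mu)%N)) big_mkcond; apply: eq_bigr => i _ /=.
  case: ifP => ik; last by rewrite big1 // => j _; case: ifP => //; lia.
  rewrite -big_mkcond; apply: (sum_ord_change (P := fun j => (0 < i + j < k.-1)%N)
    (Q := fun j => (0 < i + j < k.-1)%N) (fun j => H i j (k - (i + j))%N)) => j.
  by lia.
rewrite exchange_big; apply: eq_bigr => i _ /=.
rewrite exchange_big [RHS]big_mkcond; apply: eq_bigr => j _ /=.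
case: ifP => cond; last by rewrite big_nat big1 // => k k2; case: ifP => //; lia.
rewrite -big_mkcond /= (big_nat_widenl _ 0%N) //.
rewrite (eq_bigl (fun k => (2 + (i + j) <= k)%N)); last by move=> k; lia.
rewrite -(big_nat_widenl _ 0%N _ xpredT) // big_addn subSn; last by lia.
by apply: eq_bigr => m _; rewrite addnK.
Qed.

Section Elimination.
Variables (K : comNzRingType) (V : lmodType K).

(** A family of k-linear maps, one for each k, is encoded as one function on
    sequences of vectors, the length being the degree. *)
Definition multilinear (W : lmodType K) (F : seq V -> W) :=
  forall l1 l2 a u v,
    F (l1 ++ (a *: u + v) :: l2) = a *: F (l1 ++ u :: l2) + F (l1 ++ v :: l2).

Variables (e : V) (A : seq V -> V) (B : seq V -> K^o).

(** The j-linear coefficient of t^i v^j after the elimination of all monomials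
    of smaller degree that contain v.  The first term is its coefficient in
    B(w^(i + j)); the sum comes from the smaller monomials (i', j'), whose first
    argument is replaced by - A(w^m) with m = i + j - (i' + j') + 1.  The
    recursion is the one of [c_rec] with forms and signs in place of
    binomials, so that the bound by [c_rec] is a direct induction. *)
Fixpoint elim_rec (s i j : nat) (l : seq V) : K^o :=
  if s is s'.+1 then
    'C(i + j, j)%:R * B (nseq i e ++ l) -
    \sum_(i' < i.+1) \sum_(j' < j.+2 | (0 < j')%N && (2 <= i' + j' < i + j)%N)
      'C((i + j - (i' + j')).+1, i - i')%:R *
      elim_rec s' i' j'
        (A (nseq (i - i') e ++ take (j.+1 - j') l) :: drop (j.+1 - j') l)
  else 0.

Definition elim_form i j := elim_rec (i + j) i j.

Lemma elim_rec_stable s i j l : (0 < i + j)%N -> (i + j <= s)%N ->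
  elim_rec s i j l = elim_form i j l.
Proof.
rewrite /elim_form; elim/ltn_ind: s i j l => -[|s] IH i j l ij0 ijs; first lia.
rewrite -(prednK ij0) /=; congr (_ - _).
apply: eq_bigr => i' _; apply: eq_bigr => j' /and3P[j'0 h1 h2]; congr (_ * _).
by rewrite !IH //; lia.
Qed.

Lemma elim_formE i j l : (0 < i + j)%N ->
  elim_form i j l = 'C(i + j, j)%:R * B (nseq i e ++ l) -
    \sum_(i' < i.+1) \sum_(j' < j.+2 | (0 < j')%N && (2 <= i' + j' < i + j)%N)
      'C((i + j - (i' + j')).+1, i - i')%:R *
      elim_form i' j'
        (A (nseq (i - i') e ++ take (j.+1 - j') l) :: drop (j.+1 - j') l).
Proof.
move=> ij0; rewrite {1}/elim_form -{1}(prednK ij0) /=; congr (_ - _).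
apply: eq_bigr => i' _; apply: eq_bigr => j' /and3P[j'0 h1 h2]; congr (_ * _).
by rewrite elim_rec_stable //; lia.
Qed.

Hypotheses (linA : multilinear A) (linB : multilinear B).

(** Linearity in the first argument is what allows the substitution of a
    sum for v; the induction needs the other ones as well, since the arguments that
    A does not absorb remain arguments of the smaller form. *)
Lemma elim_form_multilinear i j : multilinear (elim_form i j).
Proof.
rewrite /elim_form; move: (i + j)%N => s; elim: s i j => [|s IH] i j l1 l2 a u v /=.
  by rewrite scaler0 addr0.
have -> : B (nseq i e ++ l1 ++ (a *: u + v) :: l2) =
    a * B (nseq i e ++ l1 ++ u :: l2) + B (nseq i e ++ l1 ++ v :: l2).
  by rewrite !catA linB.
rewrite scalerBr addrACA -opprD; congr (_ - _).
  by rewrite mulrDr mulrCA.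
rewrite scaler_sumr -big_split /=; apply: eq_bigr => i' _.
rewrite scaler_sumr -big_split /=; apply: eq_bigr => j' _.
rewrite scalerAr -mulrDr; congr (_ * _).
set k := (j.+1 - j')%N.
have [kl|lk] := leqP k (size l1).
  rewrite !takel_cat // !drop_cat.
  case: ltnP => [_|lk]; first by rewrite -!cat_cons IH.
  have ->: (k - size l1 = 0)%N by lia.
  by rewrite !drop0 -[_ :: _ :: _](cat1s _ (_ :: _)) IH.
rewrite !take_cat !drop_cat ltnNge (ltnW lk) /=.
have ->: (k - size l1 = (k - size l1).-1.+1)%N by lia.
rewrite /= !catA linA.
by rewrite -[RHS](IH _ _ [::]).
Qed.

Lemma multilinear0 (W : lmodType K) (F : seq V -> W) l1 l2 :
  multilinear F -> F (l1 ++ 0 :: l2) = 0.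
Proof.
move=> linF; have := linF l1 l2 1 0 0; rewrite !scale1r addr0 => /eqP.
by rewrite -subr_eq0 opprD addrA subrr sub0r oppr_eq0 => /eqP.
Qed.

Lemma multilinear_sum (W : lmodType K) (F : seq V -> W) l1 l2 I r (P : pred I)
    (c : I -> K) (u : I -> V) : multilinear F ->
  F (l1 ++ (\sum_(i <- r | P i) c i *: u i) :: l2) =
  \sum_(i <- r | P i) c i *: F (l1 ++ u i :: l2).
Proof.
move=> linF; elim: r => [|i r IH]; first by rewrite !big_nil multilinear0.
by rewrite !big_cons; case: (P i); rewrite // linF IH.
Qed.

Variables (t : K) (v : V).
Let w := t *: e + v.

Hypotheses (binA : forall m, A (nseq m w) =
    \sum_(r < m.+1) ('C(m, r)%:R * t ^+ r) *: A (nseq r e ++ nseq (m - r) v))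
  (binB : forall m, B (nseq m w) =
    \sum_(r < m.+1) ('C(m, r)%:R * t ^+ r) *: B (nseq r e ++ nseq (m - r) v)).

Let term i j (u : V) := t ^+ i * elim_form i j.+1 (u :: nseq j v).

(** In a fixed degree the binomials of the recursion recombine the values
    A(e^r, v^(m - r)) into A(w^m), and likewise for B. *)
Lemma elim_order k : (0 < k)%N ->
  \sum_(i < k.+1) t ^+ i * elim_form i (k - i) (nseq (k - i) v) =
  B (nseq k w) - \sum_(i < k) \sum_(j < k | (0 < i + j < k.-1)%N)
    term i j (A (nseq (k - (i + j)) w)).
Proof.
move=> k0; pose G i i' j' := 'C((k - (i' + j')).+1, i - i')%:R * (t ^+ i *
   elim_form i' j' (A (nseq (i - i') e ++ nseq ((k - i).+1 - j') v) :: nseq j'.-1 v)).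
transitivity (B (nseq k w) - \sum_(i < k.+1) \sum_(i' < i.+1)
    \sum_(j' < (k - i).+2 | (0 < j')%N && (2 <= i' + j' < k)%N) G i i' j').
  rewrite binB -sumrB; apply: eq_bigr => i _.
  have ik : (i + (k - i) = k)%N by have := ltn_ord i; lia.
  rewrite elim_formE ik // mulrBr; congr (_ - _).
    rewrite bin_sub; last by rewrite -ltnS.
    by rewrite mulrA [t ^+ i * _]mulrC.
  rewrite mulr_sumr; apply: eq_bigr => i' _.
  rewrite mulr_sumr; apply: eq_bigr => j' /andP[j'0 _].
  rewrite mulrCA /G; congr (_ * (_ * elim_form _ _ (A (_ ++ _) :: _))).
    by rewrite take_nseq //; lia.
  by rewrite drop_nseq; congr nseq; have := ltn_ord j'; lia.
rewrite elim_sum_exchange; congr (_ - _).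
apply: eq_bigr => i _; apply: eq_bigr => j Pij.
rewrite /term binA.
rewrite -[_ :: nseq j v]cat0s multilinear_sum; last exact: elim_form_multilinear.
rewrite mulr_sumr; apply: eq_bigr => r _ /=.
rewrite /G addKn exprD.
have ->: ((k - (i + r)).+1 - j.+1 = k - (i + j) - r)%N by clear; lia.
have ->: ((k - (i + j.+1)).+1 = k - (i + j))%N by move: Pij; clear; lia.
rewrite -[_ *: elim_form _ _ _]/(_ * _) -!mulrA.
by rewrite [LHS]mulrCA.
Qed.

(** Summing the previous identity over all degrees up to mu, each monomial of
    degree less than mu that contains v meets its substitutes and cancels up
    to v + sum A(w^m), which is small when the first equations almost hold. *)
Lemma elimination mu : (1 < mu)%N ->
  \sum_(2 <= k < mu.+1) t ^+ k * elim_form k 0 [::] +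
  \sum_(1 <= j < mu.+1) t ^+ (mu - j) * elim_form (mu - j) j (nseq j v) =
  \sum_(2 <= m < mu.+1) B (nseq m w) -
  \sum_(i < mu) \sum_(j < mu | (0 < i + j < mu.-1)%N)
    term i j (v + \sum_(2 <= m < (mu - (i + j)).+1) A (nseq m w)).
Proof.
move=> mu1; pose F i j := t ^+ i * elim_form i j (nseq j v).
pose S := \sum_(i < mu) \sum_(j < mu | (0 < i + j < mu.-1)%N) F i j.+1.
apply: (addrI S).
transitivity (\sum_(2 <= k < mu.+1) \sum_(i < k.+1) F i (k - i)%N).
  under [RHS]eq_bigr do rewrite big_ord_recr /= subnn.
  rewrite big_split /= [X in _ = X + _]big_nat_recr //= sum_antidiagonals -/S.
  rewrite [in RHS]addrAC -!addrA; congr (_ + (_ + _)).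
  rewrite big_add1 /= big_nat_rev /= big_mkord; apply: eq_bigr => i _.
  rewrite -[v :: _]/(nseq _.+1 v).
  have ->: ((0 + mu - i.+1).+1 = mu - i)%N by have := ltn_ord i; lia.
  by rewrite subKn // ltnW.
rewrite (eq_big_nat _ _ (F2 := fun k => B (nseq k w) - \sum_(i < k)
   \sum_(j < k | (0 < i + j < k.-1)%N) term i j (A (nseq (k - (i + j)) w)))); last first.
  by move=> k /andP[k2 _]; rewrite -elim_order // ltnW.
rewrite sumrB addrCA; congr (_ + _).
(* The substitutes of a monomial are regrouped by the degree m of A. *)
rewrite (sum_shifted_order _ (fun i j m => term i j (A (nseq m w)))).
rewrite -[RHS]opprB; congr (- _).
apply/eqP; rewrite eq_sym subr_eq addrC -big_split; apply/eqP/eq_bigr => i _ /=.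
rewrite -big_split; apply: eq_bigr => j _ /=.
have linT := elim_form_multilinear i j.+1.
rewrite /term /F /=.
have linT1 u : elim_form i j.+1 (v + u :: nseq j v) =
    elim_form i j.+1 (v :: nseq j v) + elim_form i j.+1 (u :: nseq j v).
  by have := linT [::] (nseq j v) 1 v u; rewrite !scale1r.
rewrite linT1 mulrDr; congr (_ + _); under eq_bigr do rewrite -[A _]scale1r.
rewrite -[_ :: nseq j v]cat0s multilinear_sum // mulr_sumr.
by apply: eq_bigr => m _; rewrite scale1r.
Qed.

End Elimination.

(** * Taylor expansion of multivariate polynomials *)

Section Taylor.
Variables (K : numFieldType) (n : nat).
Implicit Types (h L : {mpoly K[n]}) (x w : 'I_n -> K) (a b : 'X_{1..n}).

Lemma sum_msupp (phi : 'X_{1..n} -> K) N L : (msize L <= N)%N ->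
  \sum_(a <- msupp L) L@_a * phi a = \sum_(a : 'X_{1..n < N}) L@_a * phi a.
Proof.
move=> LN; rewrite (big_mksub ('X_{1..n < N} : subFinType _)) ?msupp_uniq //=; first last.
  by move=> a /msize_mdeg_lt /leq_trans; apply.
by rewrite big_rmcond //= => a /memN_msupp_eq0 ->; rewrite mul0r.
Qed.

Definition translate x : n.-tuple {mpoly K[n]} := [tuple 'X_i + (x i)%:MP | i < n].

Lemma mderiv_translate x i h :
  (h \mPo translate x)^`M(i) = h^`M(i) \mPo translate x.
Proof.
elim/mpolyind: h => [|c m p _ _ IH]; first by rewrite !(comp_mpoly0, mderiv0).
rewrite !(comp_mpolyD, mderivD) IH; congr (_ + _).
rewrite !(comp_mpolyZ, mderivZ); congr (_ *: _).
have [k mk] : exists k, mdeg m = k by exists (mdeg m).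
elim: k m mk {c p IH} => [|k IH] m mk.
  move/eqP: mk; rewrite mdeg_eq0 => /eqP->.
  by rewrite mpolyX0 comp_mpoly1 -mpolyC1 !mderivC comp_mpoly0.
have [j mj] : exists j, (0 < m j)%N.
  apply/existsP; apply: contraPT mk; rewrite negb_exists => /forallP m0.
  rewrite mdegE big1 // => j _; apply/eqP; rewrite -leqn0 leqNgt; exact: m0.
have jm : (U_(j) <= m)%MM.
  by apply/mnm_lepP => l; rewrite mnm1E; case: eqP => // <-.
have em := submK jm; rewrite -em mpolyXD rmorphM /= !mderivM rmorphD !rmorphM /=.
rewrite IH; last by move: mk; rewrite -{1}em mdegD mdeg1 addn1 => -[].
congr (_ + _ * _); rewrite comp_mpolyXU mderivX mnm1E -tnth_nth tnth_mktuple.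
rewrite mderivD mderivC addr0 mderivX mnm1E.
case: eqP => [->|_]; last by rewrite !scale0r comp_mpoly0.
have ->: (U_(i) - U_(i) = 0)%MM.
  by apply/mnmP => l; rewrite mnmBE subnn mnm0E.
by rewrite mpolyX0 !scale1r comp_mpoly1.
Qed.

Lemma mderivm_translate x a h :
  (h \mPo translate x)^`M[a] = h^`M[a] \mPo translate x.
Proof.
rewrite /mderivm; elim: (enum _) => //= i s IH.
by elim: (a i) => [|k IHk] //=; rewrite IHk mderiv_translate.
Qed.

Lemma meval_translate x w h :
  (h \mPo translate x).@[w] = h.@[fun i => x i + w i].
Proof.
rewrite comp_mpoly_meval; apply: meval_eq => i.
by rewrite tnth_mktuple mevalD mevalXU mevalC addrC.
Qed.

Definition mfact a := (\prod_(i < n) (a i)`!)%N.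

Lemma mfact_neq0 a : (mfact a)%:R != 0 :> K.
Proof. by rewrite pnatr_eq0 -lt0n prodn_gt0 // => i; rewrite fact_gt0. Qed.

Lemma mcoeff_translate x a h :
  (h \mPo translate x)@_a = (h^`M[a]).@[x] / (mfact a)%:R.
Proof.
apply: (mulIf (mfact_neq0 a)); rewrite divfK ?mfact_neq0 //.
transitivity (((h \mPo translate x)^`M[a])@_0).
  rewrite mcoeff_mderivm addm0 mulr_natr; congr (_ *+ _).
  by apply: eq_bigr => i _; rewrite ffactnn.
rewrite mderivm_translate.
transitivity ((h^`M[a] \mPo translate x).@[fun=> 0]).
  rewrite mevalE; set q := _ \mPo _.
  rewrite (sum_msupp (fun a => \prod_(i < n) 0 ^+ a i) (leqnSn _)).
  have q0 : (mdeg (0%MM : 'X_{1..n}) < (msize q).+1)%N by rewrite mdeg0.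
  rewrite (bigD1 (BMultinom q0)) //= [X in _ + X]big1 ?addr0.
    by rewrite big1 ?mulr1 // => i _; rewrite mnm0E.
  move=> b; rewrite -val_eqE /= -mdeg_eq0 mdegE sum_nat_eq0 negb_forall => /existsP[i bi].
  by move: bi; rewrite implyTb => bi; rewrite (bigD1 i) //= expr0n (negPf bi) mul0r mulr0.
by rewrite meval_translate; apply: meval_eq => i; rewrite addr0.
Qed.

Lemma mderivm_eq0 a h : (msize h <= mdeg a)%N -> h^`M[a] = 0.
Proof.
move=> ha; apply/mpolyP => b; rewrite mcoeff_mderivm mcoeff0 memN_msupp_eq0 ?mul0rn //.
by apply: msize_mdeg_ge; rewrite mdegD (leq_trans ha) // leq_addr.
Qed.

Lemma msize_translate x h : (msize (h \mPo translate x) <= msize h)%N.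
Proof.
rewrite msizeE; apply/bigmax_leqP_seq => a.
rewrite mcoeff_msupp mcoeff_translate => a0 _; rewrite ltnNge.
by apply: contra a0 => /mderivm_eq0 ->; rewrite meval0 mul0r.
Qed.

(** The coefficients of h(x + w) as a polynomial in w are recovered by
    differentiating at w = 0, where translation commutes with derivatives. *)
Lemma Taylor_multinomial x w N h : (msize h <= N)%N ->
  h.@[fun i => x i + w i] =
  \sum_(a : 'X_{1..n < N})
     (h^`M[a]).@[x] / (mfact a)%:R * \prod_(i < n) w i ^+ a i.
Proof.
move=> hN; rewrite -meval_translate mevalE.
rewrite (sum_msupp _ (leq_trans (msize_translate _ _) hN)).
by apply: eq_bigr => a _; rewrite mcoeff_translate.
Qed.

Lemma mcoeff_mulX L b a :
  (L * 'X_[b])@_a = if (b <= a)%MM then L@_(a - b) else 0.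
Proof.
case: ifP => ba; first by rewrite -{1}(submK ba) addmC mcoeffMX.
rewrite (mpolyE L) mulr_suml raddf_sum big1 //= => c _.
rewrite -scalerAl -mpolyXD mcoeffZ mcoeffX; case: eqP => [ca|_]; last by rewrite mulr0.
by move: ba; rewrite -ca lem_addl.
Qed.

(** The value at x of the constant-coefficient differential operator with
    symbol L, applied to h.  Working with symbols turns the symmetric
    multilinear maps D^k h(x) into products in a commutative ring: symmetry,
    multilinearity and the binomial formula are then those of the ring. *)
Definition pairing x L h := \sum_(a <- msupp L) L@_a * (h^`M[a]).@[x].

Lemma sum_msupp_linear (phi : 'X_{1..n} -> K) c L L' :
  \sum_(a <- msupp (c *: L + L')) (c *: L + L')@_a * phi a =
  c * (\sum_(a <- msupp L) L@_a * phi a) + \sum_(a <- msupp L') L'@_a * phi a.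
Proof.
pose N := maxn (msize (c *: L + L')) (maxn (msize L) (msize L')).
have [N1 N2 N3] : [/\ msize (c *: L + L') <= N, msize L <= N & msize L' <= N]%N.
  by rewrite /N !leq_max !leqnn !orbT.
rewrite (sum_msupp _ N1) (sum_msupp _ N2) (sum_msupp _ N3).
rewrite mulr_sumr -big_split; apply: eq_bigr => a _ /=.
by rewrite mcoeffD mcoeffZ mulrDl mulrA.
Qed.

Lemma pairing_linear x h c L L' :
  pairing x (c *: L + L') h = c * pairing x L h + pairing x L' h.
Proof. exact: sum_msupp_linear. Qed.

Lemma pairing0 x h : pairing x 0 h = 0.
Proof. by rewrite /pairing msupp0 big_nil. Qed.

Lemma pairing_sum x h I (r : seq I) (P : pred I) (c : I -> K) (L : I -> {mpoly K[n]}) :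
  pairing x (\sum_(i <- r | P i) c i *: L i) h =
  \sum_(i <- r | P i) c i * pairing x (L i) h.
Proof.
elim: r => [|i r IH]; first by rewrite !big_nil pairing0.
by rewrite !big_cons; case: (P i); rewrite // pairing_linear IH.
Qed.

Lemma pairingX x a h : pairing x 'X_[a] h = (h^`M[a]).@[x].
Proof. by rewrite /pairing msuppX big_seq1 mcoeffX eqxx mul1r. Qed.

(** The symbol of the derivative in the direction w. *)
Definition linform w : {mpoly K[n]} := \sum_(i < n) w i *: 'X_i.

Lemma pairing_prod_linform x h k (w : 'I_k -> 'I_n -> K) :
  pairing x (\prod_(l < k) linform (w l)) h =
  \sum_(j : {ffun 'I_k -> 'I_n})
     (h^`M[(\sum_(l < k) U_(j l))%MM]).@[x] * \prod_(l < k) w l (j l).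
Proof.
rewrite bigA_distr_bigA /=.
under eq_bigr => j _ do
  rewrite scaler_prod -(big_morph _ (@mpolyXD n K) (mpolyX0 n K)).
by rewrite pairing_sum; apply: eq_bigr => j _; rewrite pairingX mulrC.
Qed.

(** The multinomial theorem, in the form needed to compare the two Taylor
    formulas. *)
Lemma mcoeff_linformX w k a : (linform w ^+ k)@_a =
  if mdeg a == k then k`!%:R / (mfact a)%:R * \prod_(i < n) w i ^+ a i else 0.
Proof.
elim: k a => [|k IH] a.
  rewrite expr0 mcoeff1 mdeg_eq0; case: eqP => [->|//].
  rewrite /mfact !big1 ?divr1 ?mulr1 // => i _; by rewrite mnm0E.
rewrite exprSr mulr_sumr raddf_sum /=.
rewrite (eq_bigr (fun i => if mdeg a == k.+1 then
  k`!%:R / (mfact a)%:R * (\prod_(i < n) w i ^+ a i) * (a i)%:R else 0)); last first.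
  move=> i _; rewrite -scalerAr mcoeffZ mcoeff_mulX lep1mP.
  have [ai|ai] := posnP (a i); first by rewrite ai /= !mulr0 if_same.
  rewrite /=.
  have ia : (U_(i) <= a)%MM by rewrite lep1mP -lt0n.
  move: IH; move: (a - U_(i))%MM (submK ia) => b <-  IH {ia ai}.
  rewrite IH mdegD mdeg1 addn1 eqSS; case: ifP => _; last by rewrite mulr0.
  have -> : mfact (b + U_(i))%MM = ((b i).+1 * mfact b)%N.
    rewrite /mfact (bigD1 i) //= [in RHS](bigD1 i) //= mulnA; congr (_ * _)%N.
      by rewrite mnmDE mnm1E eqxx addn1 factS.
    apply: eq_bigr => j ji; by rewrite mnmDE mnm1E eq_sym (negPf ji) addn0.
  have -> : \prod_(j < n) w j ^+ (b + U_(i))%MM j = w i * \prod_(j < n) w j ^+ b j.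
    rewrite (bigD1 i) //= [in RHS](bigD1 i) //= mulrA; congr (_ * _).
      by rewrite mnmDE mnm1E eqxx addn1 exprS.
    apply: eq_bigr => j ji; by rewrite mnmDE mnm1E eq_sym (negPf ji) addn0.
  rewrite mnmDE mnm1E eqxx addn1 natrM invfM.
  have bi0 : (b i).+1%:R != 0 :> K by rewrite pnatr_eq0.
  rewrite -[in RHS]mulrA mulrC; field. by rewrite mfact_neq0 nat1r.
case: ifP => [/eqP ak|_]; last by rewrite big1.
rewrite -mulr_sumr -natr_sum -mdegE ak factS natrM.
by field; rewrite mfact_neq0.
Qed.

Lemma msize_linformX w k : (msize (linform w ^+ k) <= k.+1)%N.
Proof.
rewrite msizeE; apply/bigmax_leqP_seq => a.
rewrite mcoeff_msupp mcoeff_linformX; case: ifP => [/eqP-> //|_].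
by rewrite eqxx.
Qed.

Lemma Taylor_homogeneous x w N h : (msize h <= N)%N ->
  h.@[fun i => x i + w i] =
  \sum_(k < N) k`!%:R^-1 * pairing x (linform w ^+ k) h.
Proof.
move=> hN; rewrite (Taylor_multinomial _ _ hN).
under [RHS]eq_bigr => k _ do
  rewrite /pairing (sum_msupp _ (leq_trans (msize_linformX w k) (ltn_ord k))) mulr_sumr.
rewrite exchange_big; apply: eq_bigr => a _ /=.
rewrite (bigD1 (Ordinal (bmdeg a))) //= [X in _ + X]big1 ?addr0.
  rewrite mcoeff_linformX eqxx !mulrA mulVf ?mul1r; last by rewrite pnatr_eq0 -lt0n fact_gt0.
  by rewrite [RHS]mulrC !mulrA.
move=> k; rewrite -val_eqE /= => ka.
by rewrite mcoeff_linformX eq_sym (negPf ka) mul0r mulr0.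
Qed.

End Taylor.

(** * The curve traced by the dual sequence *)

Section Curve.
Variables (R : realType) (n : nat).
Local Notation C := R[i].
Variables (f : system R n n.+1) (x : 'cV[C]_n.+1) (mu : nat).

Lemma apply_functional_linear c L L' h :
  apply_functional (c *: L + L') x h =
  c * apply_functional L x h + apply_functional L' x h.
Proof. exact: sum_msupp_linear. Qed.

Lemma apply_functional0 h : apply_functional 0 x h = 0.
Proof. by rewrite /apply_functional msupp0 big_nil. Qed.

Lemma apply_functionalXU s h :
  apply_functional 'X_s x h = evalp (h^`M(s)) x.
Proof.
rewrite /apply_functional msuppX big_seq1 mcoeffX eqxx mul1r mderivmU1m.
rewrite big1 ?divr1 // => i _; rewrite mnm1E; by case: eqP.
Qed.

Lemma apply_functional_sumXU h (P : pred 'I_n.+1) (c : 'I_n.+1 -> C) :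
  apply_functional (\sum_(s | P s) c s *: 'X_s) x h =
  \sum_(s | P s) c s * evalp (h^`M(s)) x.
Proof.
elim: (index_enum _) => [|s r IH]; first by rewrite !big_nil apply_functional0.
rewrite !big_cons; case: (P s); last exact: IH.
by rewrite apply_functional_linear IH apply_functionalXU.
Qed.

Lemma mcoeff_Psi s (L : functional R n) a :
  (Psi s L)@_a =
  if (U_(s) <= a)%MM && [forall t : 'I_n.+1, (t < s)%N ==> (a t == 0%N)]
  then L@_(a - U_(s)) else 0.
Proof.
rewrite /Psi raddf_sum /=; under eq_bigr => b _ do rewrite mcoeffZ mcoeffX.
case: (boolP (U_(s) <= a)%MM) => [sa|nsa] /=; last first.
  rewrite big1 // => b _; case: eqP => [ba|]; last by rewrite mulr0.
  by case/negP: nsa; rewrite -ba lem_addl.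
move: (a - U_(s))%MM (submK sa) => c <- {a sa}.
have ->: [forall t : 'I_n.+1, (t < s)%N ==> ((c + U_(s))%MM t == 0%N)] =
         [forall t : 'I_n.+1, (t < s)%N ==> (c t == 0%N)].
  apply: eq_forallb => t; rewrite mnmDE mnm1E.
  by case: (s =P t) => [->|_]; rewrite ?ltnn ?addn0.
rewrite [in RHS](mpolyE L) raddf_sum /= big_mkcond /=.
set b0 := [forall t, _]; transitivity (\sum_(b <- msupp L) L@_b * (b == c)%:R * b0%:R).
  apply: eq_bigr => b _; rewrite eqm_add2r; have [->|_] := eqVneq b c.
    by rewrite -/b0; case: b0; rewrite !(mulr1, mulr0).
  by rewrite !mulr0 mul0r if_same.
rewrite -mulr_suml; case: b0; rewrite ?mulr1 ?mulr0 //.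
by apply: eq_bigr => b _; rewrite mcoeffZ mcoeffX.
Qed.

Definition curve (s : 'I_n.+1) : {poly C} :=
  \sum_(1 <= k < mu) coefa f x k s 0 *: 'X^k.

Definition curve_monomial (a : 'X_{1..n.+1}) : {poly C} :=
  \prod_s curve s ^+ a s.

Lemma coef_curve s k :
  (curve s)`_k = if (1 <= k < mu)%N then coefa f x k s 0 else 0.
Proof.
rewrite /curve coef_sum; under eq_bigr => j _ do rewrite coefZ coefXn.
case: ifP => k1; last first.
  rewrite big_nat big1 // => j j1; case: eqP => [kj|]; rewrite ?mulr0 //.
  by move: k1; rewrite kj j1.
rewrite (bigD1_seq k) ?mem_index_iota ?iota_uniq //= eqxx mulr1 big1 ?addr0 //.
by move=> j jk; rewrite eq_sym (negPf jk) mulr0.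
Qed.

Lemma curve_monomialD a b :
  curve_monomial (a + b)%MM = curve_monomial a * curve_monomial b.
Proof.
by rewrite /curve_monomial -big_split; apply: eq_bigr => s _; rewrite mnmDE exprD.
Qed.

Lemma curve_monomialU s : curve_monomial U_(s)%MM = curve s.
Proof.
rewrite /curve_monomial (bigD1 s) //= mnm1E eqxx big1 ?mulr1 // => t ts.
by rewrite mnm1E eq_sym (negPf ts).
Qed.

Lemma curve_monomial0 : curve_monomial 0%MM = 1.
Proof. by rewrite /curve_monomial big1 // => s _; rewrite mnm0E. Qed.

(** The curve has no constant term. *)
Lemma coef_curve_monomial_small a k : (k < mdeg a)%N -> (curve_monomial a)`_k = 0.
Proof.
have -> : curve_monomial a = 'X^(mdeg a) *
    \prod_s (\sum_(0 <= k < mu.-1) coefa f x k.+1 s 0 *: 'X^k) ^+ a s.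
  rewrite mdegE /curve_monomial -prodrXr -big_split; apply: eq_bigr => s _ /=.
  rewrite -exprMn; congr (_ ^+ _); rewrite mulr_sumr /curve.
  by rewrite big_add1; apply: eq_bigr => j _; rewrite -scalerAr exprS.
by move=> ka; rewrite coefXnM ka.
Qed.

(** The generating function of the Lambda_j is the product over s of
    1 / (1 - c_s(t) d_s).  The operator Psi_s restores the smallest index s of a
    monomial, so each monomial is produced exactly once, and the convolution
    sum_j a_(j,s) Lambda_(k - j) is the coefficient of t^k in c_s times the other
    factors of the monomial. *)
Lemma mcoeff_Delta k a : (2 <= k <= mu)%N ->
  (forall j b, (1 <= j < k)%N -> (Lambda f x j)@_b = (curve_monomial b)`_j) ->
  (Delta f x k)@_a = if (2 <= mdeg a)%N then (curve_monomial a)`_k else 0.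
Proof.
move=> /andP[k2 kmu] IH; rewrite DeltaE // raddf_sum /=.
under eq_bigr => s _ do rewrite mcoeff_Psi.
case: (pickP (fun s => a s != 0%N)) => [s0 as0|a0]; last first.
  have ->: a = 0%MM by apply/mnmP => s; rewrite mnm0E; have /eqP := a0 s.
  rewrite mdeg0 big1 // => s _; rewrite lep1mP mnm0E eqxx //.
(* Only the smallest index s of the monomial survives in the sum over s. *)
case: (@arg_minnP _ s0 (fun s => a s != 0%N) val as0) => s as1 smin {s0 as0}.
have sa : (U_(s) <= a)%MM by rewrite lep1mP.
rewrite (bigD1 s) //= [X in _ + X]big1 ?addr0; last first.
  move=> t ts; case: ifP => // /andP[]; rewrite lep1mP => at0 /forallP /(_ s).
  rewrite (negPf as1) implybF -leqNgt => st.
  by case/eqP: ts; apply/val_inj/eqP; rewrite /= eqn_leq st smin.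
rewrite sa; have -> : [forall t : 'I_n.+1, (t < s)%N ==> (a t == 0%N)].
  apply/forallP => t; apply/implyP => ts; apply: contraTT ts => /smin.
  by rewrite -leqNgt.
rewrite /=; move: (a - U_(s))%MM (submK sa) => b <- {a sa as1 smin}.
rewrite raddf_sum /= mdegD mdeg1 addn1 ltnS.
rewrite (eq_big_nat _ _ (F2 := fun j => (curve s)`_j * (curve_monomial b)`_(k - j))); last first.
  move=> j /andP[j1 jk]; rewrite mcoeffZ IH; last by lia.
  by rewrite coef_curve j1 (leq_trans jk kmu).
case: ifP => [b1|b0].
  rewrite addmC curve_monomialD curve_monomialU coefM.
  rewrite -(big_mkord xpredT (fun j => (curve s)`_j * (curve_monomial b)`_(k - j))).
  rewrite big_nat_recr //= subnn (coef_curve_monomial_small b1) mulr0 addr0.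
  rewrite [RHS]big_ltn; last by lia.
  by rewrite coef_curve mul0r add0r.
have ->: b = 0%MM by apply/eqP; rewrite -mdeg_eq0; lia.
rewrite curve_monomial0 big_nat big1 // => j jk.
by rewrite coef1; case: eqP; rewrite ?mulr0 //; lia.
Qed.

Lemma coefa_ord0 k : (2 <= k)%N -> coefa f x k ord0 0 = 0.
Proof.
move=> k2; rewrite coefaE //.
rewrite mxE; case: splitP => [j _|j /= k0]; first by rewrite mxE.
by move: k0; rewrite add1n.
Qed.

Lemma LambdaE_sum k : (1 <= k)%N -> Lambda f x k =
  (if (2 <= k)%N then Delta f x k else 0) + \sum_s coefa f x k s 0 *: 'X_s.
Proof.
case: k => [|[|k]] // _; last first.
  rewrite /= LambdaE // [in RHS](bigD1 ord0) //= coefa_ord0 //.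
  by rewrite scale0r add0r.
rewrite /= add0r Lambda1 (bigD1 ord0) //= coefa1 !mxE eqxx scale1r big1 ?addr0 //.
by move=> s s0; rewrite mxE (negPf s0) scale0r.
Qed.

Lemma mcoeff_Lambda k a : (1 <= k < mu)%N ->
  (Lambda f x k)@_a = (curve_monomial a)`_k.
Proof.
elim/ltn_ind: k a => k IH a k1; rewrite LambdaE_sum; last by case/andP: k1.
rewrite mcoeffD; have -> : (if (2 <= k)%N then Delta f x k else 0)@_a =
    if (2 <= mdeg a)%N then (curve_monomial a)`_k else 0.
  case: ifP => k2.
    apply: mcoeff_Delta => [|j b /andP[j1 jk]]; first by lia.
    by apply: IH => //; lia.
  rewrite mcoeff0; case: ifP => // a2.
  by rewrite coef_curve_monomial_small //; lia.
have [a2|a1] := leqP 2 (mdeg a).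
  rewrite raddf_sum big1 ?addr0 //= => s _; rewrite mcoeffZ mcoeffX.
  by case: eqP a2 => [<-|_]; rewrite ?mdeg1 // mulr0.
rewrite add0r raddf_sum /=; under eq_bigr => s _ do rewrite mcoeffZ mcoeffX.
have [a0|] := posnP (mdeg a).
  have ->: a = 0%MM by apply/eqP; rewrite -mdeg_eq0 a0.
  rewrite curve_monomial0 coef1 big1; first by case: eqP => // k0; lia.
  by move=> s _; rewrite mnm1_eq0 mulr0.
move=> a0; have /mdeg1P[t /eqP->] : mdeg a == 1%N by lia.
rewrite curve_monomialU coef_curve k1 (bigD1 t) //= eqxx mulr1 big1 ?addr0 //.
by move=> s st; rewrite eq_mnm1 (negPf st) mulr0.
Qed.

(** The functionals of the dual sequence read off the coefficients of h along
    the curve truncated before degree mu; the last one available is the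
    coefficient of t^mu, given by Delta_mu since a_mu is absent. *)
Lemma curve_expansion h : (2 <= mu)%N -> exists P : {poly C},
  [/\ forall t, P.[t] = evalp h (x + \col_s (curve s).[t]),
      P`_0 = evalp h x,
      forall k, (1 <= k < mu)%N -> P`_k = apply_functional (Lambda f x k) x h &
      P`_mu = apply_functional (Delta f x mu) x h].
Proof.
move=> mu2.
(* One bound for the degrees of h and of all the functionals involved. *)
pose N := (msize h + \sum_(k < mu) msize (Lambda f x k) + msize (Delta f x mu))%N.
pose phi a := evalp (h^`M[a]) x / (mfact a)%:R.
pose P := \sum_(a : 'X_{1..n.+1 < N}) phi a *: curve_monomial a.
have PE t : P.[t] = evalp h (x + \col_s (curve s).[t]).
  rewrite /evalp (meval_eq (v2 := fun i => x i 0 + (curve i).[t])); last first.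
    by move=> i; rewrite !mxE.
  rewrite (Taylor_multinomial _ _ (N := N)); last by rewrite /N -addnA leq_addr.
  rewrite horner_sum; apply: eq_bigr => a _; rewrite hornerZ horner_prod.
  by congr (_ * _); apply: eq_bigr => i _; rewrite horner_exp.
exists P; split => //.
- rewrite -horner_coef0 PE; congr evalp; apply/matrixP => i j.
  by rewrite !mxE horner_coef0 coef_curve addr0 ord1.
- move=> k k1; rewrite coef_sum.
  have LN : (msize (Lambda f x k) <= N)%N.
    have kmu : (k < mu)%N by lia.
    rewrite /N (bigD1 (Ordinal kmu)) //=; lia.
  rewrite /apply_functional (sum_msupp _ LN); apply: eq_bigr => a _.
  by rewrite coefZ mcoeff_Lambda // mulrC.
have LN : (msize (Delta f x mu) <= N)%N by rewrite /N; lia.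
rewrite coef_sum /apply_functional (sum_msupp _ LN); apply: eq_bigr => a _.
rewrite coefZ mcoeff_Delta ?mu2 ?leqnn //; last exact: mcoeff_Lambda.
rewrite mulrC; case: ifP => [_|a1]; congr (_ * _).
have [a0|] := posnP (mdeg a).
  have ->: (a : 'X_{1..n.+1}) = 0%MM by apply/eqP; rewrite -mdeg_eq0 a0.
  by rewrite curve_monomial0 coef1; case: eqP => // m0; lia.
move=> a0; have /mdeg1P[t /eqP->] : mdeg a == 1%N by lia.
by rewrite curve_monomialU coef_curve ltnn andbF.
Qed.

Hypothesis hnf : normalized_form f x.

Lemma coefa_lift k j : (2 <= k)%N -> coefa f x k (lift ord0 j) 0 =
  - (invmx (Dhat f x) *m
     (\col_i apply_functional (Delta f x k) x (hatf f i))) j 0.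
Proof.
move=> k2; rewrite coefaE // mxE; case: splitP => [l|l] /=.
  by rewrite /bump /= => e; have := ltn_ord l; rewrite -e.
by rewrite /bump /= !add1n => -[/val_inj <-]; rewrite mxE.
Qed.

Lemma apply_Lambda k h : (2 <= k)%N -> apply_functional (Lambda f x k) x h =
  apply_functional (Delta f x k) x h +
  \sum_(j < n) coefa f x k (lift ord0 j) 0 * evalp (h^`M(lift ord0 j)) x.
Proof.
move=> k2; rewrite LambdaE // -[X in apply_functional (X + _)]scale1r.
rewrite apply_functional_linear mul1r apply_functional_sumXU; congr (_ + _).
by rewrite big_mkcond big_ord_recl /= add0r.
Qed.

Lemma apply_Lambda1 i : apply_functional (Lambda f x 1) x (f i) = 0.
Proof.
rewrite Lambda1 apply_functionalXU.
by have [/(_ i)] := hnf; rewrite mxE.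
Qed.

(** For k >= 2 this is the equation that defines a_k; for k = 1 the first column
    of the Jacobian matrix vanishes. *)
Lemma apply_Lambda_hatf k i : (1 <= k)%N ->
  apply_functional (Lambda f x k) x (hatf f i) = 0.
Proof.
case: k => [|[|k]] // _; first exact: apply_Lambda1.
rewrite apply_Lambda //; set D := apply_functional _ _ _.
have [_ _ inv] := hnf.
pose b := \col_i apply_functional (Delta f x k.+2) x (hatf f i).
have : (Dhat f x *m - (invmx (Dhat f x) *m b)) i 0 = - D.
  by rewrite mulmxN mulmxA mulmxV // mul1mx !mxE.
rewrite mxE => E; apply/eqP; rewrite addrC addr_eq0 -E; apply/eqP.
by apply: eq_bigr => j _; rewrite coefa_lift // !mxE mulrC.
Qed.

Lemma apply_Lambda_last k : (2 <= k)%N ->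
  apply_functional (Lambda f x k) x (f ord_max) =
  apply_functional (Delta f x k) x (f ord_max).
Proof.
move=> k2; rewrite apply_Lambda // big1 ?addr0 // => j _.
by have [_ /(_ (lift ord0 j)) + _] := hnf; rewrite mxE => ->; rewrite mulr0.
Qed.

Definition curve_point (t : C) : 'cV[C]_n.+1 := \col_s (curve s).[t].

Lemma hatf_on_curve i : (2 <= mu)%N -> is_zero f x -> exists P : {poly C},
  (forall t, evalp (hatf f i) (x + curve_point t) = P.[t]) /\
  (forall k, (k < mu)%N -> P`_k = 0).
Proof.
move=> mu2 fx; have [P [PE P0 PL _]] := curve_expansion (hatf f i) mu2.
exists P; split=> [t|[|k] kmu]; [by rewrite PE | by rewrite P0; exact: fx |].
by rewrite PL ?apply_Lambda_hatf.
Qed.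

Lemma lastf_on_curve : (2 <= mu)%N -> simple_multiple_zero f x mu ->
  exists P : {poly C},
  [/\ forall t, evalp (f ord_max) (x + curve_point t) = P.[t],
      forall k, (k < mu)%N -> P`_k = 0 &
      P`_mu = apply_functional (Delta f x mu) x (f ord_max)].
Proof.
move=> mu2 [fx D0 _]; have [P [PE P0 PL PD]] := curve_expansion (f ord_max) mu2.
exists P; split=> [t|[|[|k]] kmu|//]; first by rewrite PE.
- by rewrite P0; exact: fx.
- by rewrite PL ?apply_Lambda1.
rewrite PL // apply_Lambda_last // D0 //; by move: kmu; clear; lia.
Qed.

Lemma curve_point0 t : (2 <= mu)%N -> curve_point t ord0 0 = t.
Proof.
move=> mu2; rewrite mxE (_ : curve ord0 = 'X) ?hornerX //.
apply/polyP => k; rewrite coef_curve coefX.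
case: k => [|[|k]] //; first by rewrite mu2 coefa1 mxE eqxx.
by rewrite coefa_ord0 ?if_same.
Qed.

End Curve.

(** * Norms of vectors and of multilinear maps *)

Section Norms.
Variable R : realType.
Local Notation C := R[i].
Local Notation normc := (@Normc.normc R).
Implicit Types p : nat.

Lemma normc_ge0 (z : C) : 0 <= normc z.
Proof. by case: z => a b; rewrite /= sqrtr_ge0. Qed.

Lemma normcX (z : C) k : normc (z ^+ k) = normc z ^+ k.
Proof.
by elim: k => [|k IH]; rewrite ?expr0 ?Normc.normc1 // !exprS Normc.normcM IH.
Qed.

Lemma normc_nat k : normc k%:R = k%:R.
Proof. by rewrite normcMn Normc.normc1. Qed.

Lemma normc_sum I r (P : pred I) (F : I -> C) :
  normc (\sum_(i <- r | P i) F i) <= \sum_(i <- r | P i) normc (F i).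
Proof.
elim/big_ind2: _ => [|a b c d ab cd|//]; first by rewrite Normc.normc0.
by apply: le_trans (le_normcD _ _) _; apply: lerD.
Qed.

Lemma normc_prod I r (P : pred I) (F : I -> C) :
  normc (\prod_(i <- r | P i) F i) = \prod_(i <- r | P i) normc (F i).
Proof. by apply: big_morph; [exact: Normc.normcM | exact: Normc.normc1]. Qed.

Lemma normc_real (a : R) : 0 <= a -> normc a%:C%C = a.
Proof. by move=> a0; rewrite /= expr0n addr0 sqrtr_sqr ger0_norm. Qed.

(** From (beta a_i - alpha b_i)^2 >= 0, alpha and beta being the two norms. *)
Lemma sum_cauchy p (a b : 'I_p -> R) : (forall i, 0 <= a i) -> (forall i, 0 <= b i) ->
  \sum_i a i * b i <= Num.sqrt (\sum_i a i ^+ 2) * Num.sqrt (\sum_i b i ^+ 2).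
Proof.
move=> a0 b0; set A := \sum_i a i ^+ 2; set B := \sum_i b i ^+ 2.
have A0 : 0 <= A by apply: sumr_ge0 => i _; apply: sqr_ge0.
have B0 : 0 <= B by apply: sumr_ge0 => i _; apply: sqr_ge0.
have zero (u v : 'I_p -> R) : \sum_i u i ^+ 2 = 0 -> \sum_i u i * v i = 0.
  move=> /eqP; rewrite psumr_eq0 => [/allP u0|i _]; last exact: sqr_ge0.
  rewrite big1 // => i _; have := u0 i (mem_index_enum _).
  by rewrite sqrf_eq0 => /eqP->; rewrite mul0r.
have [eA|An0] := eqVneq A 0; first by rewrite (zero a b eA) eA sqrtr0 mul0r.
have [eB|Bn0] := eqVneq B 0.
  by under eq_bigr do rewrite mulrC; rewrite (zero b a eB) eB sqrtr0 mulr0.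
set al := Num.sqrt A; set be := Num.sqrt B.
have al0 : 0 < al by rewrite sqrtr_gt0 lt_neqAle eq_sym An0.
have be0 : 0 < be by rewrite sqrtr_gt0 lt_neqAle eq_sym Bn0.
have : \sum_i (2 * (al * be)) * (a i * b i) <=
       \sum_i (be ^+ 2 * a i ^+ 2 + al ^+ 2 * b i ^+ 2).
  apply: ler_sum => i _.
  by have := sqr_ge0 (be * a i - al * b i); nra.
rewrite -mulr_sumr big_split /= -!mulr_sumr -/A -/B.
have -> : A = al ^+ 2 by rewrite sqr_sqrtr.
have -> : B = be ^+ 2 by rewrite sqr_sqrtr.
move=> h; rewrite -(ler_pM2l (_ : 0 < 2 * (al * be))) ?mulr_gt0 //.
by apply: le_trans h _; rewrite le_eqVlt; apply/orP; left; apply/eqP; ring.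
Qed.

Lemma hnorm_ge0 p (v : 'cV[C]_p) : 0 <= hnorm v.
Proof. exact: sqrtr_ge0. Qed.

Lemma hnorm_sqr p (v : 'cV[C]_p) : hnorm v ^+ 2 = \sum_i normc (v i 0) ^+ 2.
Proof. by rewrite sqr_sqrtr // sumr_ge0 // => i _; apply: sqr_ge0. Qed.

Lemma hnorm_le p (u v : 'cV[C]_p) : hnorm u ^+ 2 <= hnorm v ^+ 2 -> hnorm u <= hnorm v.
Proof. by rewrite ler_sqr // ?nnegrE ?hnorm_ge0. Qed.

Lemma normc_le_hnorm p (v : 'cV[C]_p) i : normc (v i 0) <= hnorm v.
Proof.
rewrite -ler_sqr ?nnegrE ?hnorm_ge0 ?normc_ge0 // hnorm_sqr (bigD1 i) //= lerDl.
by apply: sumr_ge0 => j _; apply: sqr_ge0.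
Qed.

Lemma hnorm0 p : hnorm (0 : 'cV[C]_p) = 0.
Proof.
by rewrite /hnorm big1 ?sqrtr0 // => i _; rewrite mxE Normc.normc0 expr0n.
Qed.

Lemma hnorm_eq0 p (v : 'cV[C]_p) : hnorm v = 0 -> v = 0.
Proof.
move=> v0; apply/matrixP => i j; rewrite ord1 mxE; apply: Normc.eq0_normc.
by apply/eqP; rewrite eq_le normc_ge0 andbT -v0 normc_le_hnorm.
Qed.

Lemma hnorm_scale p a (v : 'cV[C]_p) : hnorm (a *: v) = normc a * hnorm v.
Proof.
rewrite /hnorm; under eq_bigr do rewrite mxE Normc.normcM exprMn.
by rewrite -mulr_sumr sqrtrM ?sqr_ge0 // sqrtr_sqr ger0_norm ?normc_ge0.
Qed.

Lemma ler_hnormD p (u v : 'cV[C]_p) : hnorm (u + v) <= hnorm u + hnorm v.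
Proof.
rewrite -ler_sqr ?nnegrE ?addr_ge0 ?hnorm_ge0 // sqrrD !hnorm_sqr.
apply: le_trans (_ : \sum_i (normc (u i 0) + normc (v i 0)) ^+ 2 <= _).
  apply: ler_sum => i _; rewrite mxE ler_sqr ?nnegrE ?addr_ge0 ?normc_ge0 //.
  exact: le_normcD.
under eq_bigr do rewrite sqrrD.
rewrite !big_split /= lerD2r lerD2l -mulr2n lerMn2r /=.
by apply: sum_cauchy => i; exact: normc_ge0.
Qed.

Lemma hnorm_opp p (v : 'cV[C]_p) : hnorm (- v) = hnorm v.
Proof. by rewrite -scaleN1r hnorm_scale normcN Normc.normc1 mul1r. Qed.

Lemma hnorm_sum p I r (P : pred I) (F : I -> 'cV[C]_p) :
  hnorm (\sum_(i <- r | P i) F i) <= \sum_(i <- r | P i) hnorm (F i).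
Proof.
elim/big_ind2: _ => [|a b c d ab cd|//]; first by rewrite hnorm0.
by apply: le_trans (ler_hnormD _ _) _; apply: lerD.
Qed.

Lemma hnorm_cV1 (v : 'cV[C]_1) : hnorm v = normc (v 0 0).
Proof. by rewrite /hnorm big_ord1 sqrtr_sqr ger0_norm ?normc_ge0. Qed.

Lemma hnorm_sqr_head p (v : 'cV[C]_p.+1) :
  hnorm v ^+ 2 = normc (v ord0 0) ^+ 2 + \sum_(i < p) normc (v (lift ord0 i) 0) ^+ 2.
Proof. by rewrite hnorm_sqr big_ord_recl. Qed.

Lemma hnorm_col_mx0 p (v : 'cV[C]_p) :
  hnorm (col_mx (0 : 'cV[C]_1) v : 'cV[C]_p.+1) = hnorm v.
Proof.
congr Num.sqrt; rewrite big_ord_recl mxE; case: splitP => [j _|j /= k0]; last first.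
  by move: k0; rewrite add1n.
rewrite mxE Normc.normc0 expr0n add0r; apply: eq_bigr => i _.
rewrite mxE; case: splitP => l /=; rewrite /bump /=.
  by move=> e; have := ltn_ord l; rewrite -e.
by rewrite !add1n => -[/val_inj <-].
Qed.

End Norms.

Section OperatorNorm.
Variables (R : realType) (n : nat).
Local Notation C := R[i].
Local Notation normc := (@Normc.normc R).
Local Notation point := 'cV[C]_n.+1.

(** Coordinate expansion of a k-linear map; it gives both the homogeneity and
    the finiteness of the supremum that [opnorm] needs to be an operator
    norm. *)
Definition is_form k p (F : ('I_k -> point) -> 'cV[C]_p) :=
  exists u : {ffun 'I_k -> 'I_n.+1} -> 'cV[C]_p,
    forall v, F v = \sum_(j : {ffun 'I_k -> 'I_n.+1}) (\prod_l v l (j l) 0) *: u j.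

Section OneForm.
Variables (k p : nat) (F : ('I_k -> point) -> 'cV[C]_p).
Hypothesis Fform : is_form F.

Lemma form_homogeneous (c : 'I_k -> C) v :
  F (fun l => c l *: v l) = (\prod_l c l) *: F v.
Proof.
have [u Fu] := Fform; rewrite !Fu scaler_sumr; apply: eq_bigr => j _.
rewrite scalerA -big_split; congr (_ *: _).
by apply: eq_bigr => l _; rewrite mxE.
Qed.

Let values := [set hnorm (F v) | v in [set v | forall i, hnorm (v i) <= 1]]%classic.

Lemma form_bounded : has_ubound values.
Proof.
have [u Fu] := Fform; exists (\sum_j hnorm (u j)) => _ [v /= v1 <-].
rewrite Fu; apply: le_trans (hnorm_sum _ _ _) _; apply: ler_sum => j _.
rewrite hnorm_scale ler_piMl ?hnorm_ge0 // normc_prod.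
apply: prodr_ile1 => l _; rewrite normc_ge0 /=.
exact: le_trans (normc_le_hnorm _ _) (v1 l).
Qed.

Lemma opnorm_ge0 : 0 <= opnorm F.
Proof.
apply: le_trans (hnorm_ge0 (F (fun=> 0))) _.
apply: (ub_le_sup form_bounded); exists (fun=> 0) => //= i.
by rewrite hnorm0.
Qed.

(** By homogeneity, after scaling the vectors to unit length. *)
Lemma hnorm_le_opnorm v : hnorm (F v) <= opnorm F * \prod_l hnorm (v l).
Proof.
pose c l : C := (hnorm (v l))%:C%C; pose u l := (c l)^-1 *: v l.
(* A null vector is its own rescaling. *)
have vE : v = fun l => c l *: u l.
  apply: funext => l; rewrite /u /c; have [v0|v0] := eqVneq (hnorm (v l)) 0.
    by rewrite (hnorm_eq0 v0) !scaler0.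
  rewrite scalerA divff ?scale1r //.
  by apply: contra v0 => /eqP[->].
rewrite {1}vE form_homogeneous hnorm_scale mulrC normc_prod.
under eq_bigr do rewrite /c normc_real ?hnorm_ge0 //.
apply: ler_wpM2r; first by apply: prodr_ge0 => l _; apply: hnorm_ge0.
apply: (ub_le_sup form_bounded); exists u => //= l.
rewrite /u hnorm_scale Normc.normcV /c normc_real ?hnorm_ge0 //.
have [->|v0] := eqVneq (hnorm (v l)) 0; first by rewrite mulr0.
by rewrite mulVf.
Qed.

End OneForm.

Section Family.
Variables (p : nat) (F : forall k, ('I_k -> point) -> 'cV[C]_p).
Hypotheses (Fform : forall k, is_form (@F k)).
Variable N : nat.
Hypothesis F0 : forall k v, (N <= k)%N -> @F k v = 0.

Let g := Num.max 1
  (sup [set opnorm (@F k) `^ (k.-1%:R^-1) | k in [set k : nat | (2 <= k)%N]])%classic.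

(** A supremum of reals bounds its elements only if it is finite; here the
    forms vanish from some degree on, the maps being polynomial. *)
Lemma opnorm_le_gamma k : (2 <= k)%N -> opnorm (@F k) <= g ^+ k.-1.
Proof.
move=> k2; have k0 : (k.-1)%:R != 0 :> R by rewrite pnatr_eq0; lia.
have ub : has_ubound [set opnorm (@F k) `^ (k.-1%:R^-1) | k in
    [set k : nat | (2 <= k)%N]]%classic.
  exists (\sum_(k < N) opnorm (@F k) `^ (k.-1%:R^-1)) => _ [m /= m2 <-].
  have [mN|Nm] := ltnP m N.
    rewrite (bigD1 (Ordinal mN)) //= lerDl; apply: sumr_ge0 => i _.
    exact: powR_ge0.
  have -> : opnorm (@F m) = 0.
    apply/eqP; rewrite eq_le opnorm_ge0 // andbT.
    apply: ge_sup; first by exists (hnorm (@F m (fun=> 0))), (fun=> 0) => //= i; rewrite hnorm0.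
    by move=> _ [v _ <-]; rewrite F0 // hnorm0.
  rewrite powR0; first by apply: sumr_ge0 => i _; exact: powR_ge0.
  by rewrite invr_eq0 pnatr_eq0; lia.
have h : opnorm (@F k) `^ (k.-1%:R^-1) <= g.
  rewrite /g le_max; apply/orP; right.
  by apply: (ub_le_sup ub); exists k.
have -> : opnorm (@F k) = (opnorm (@F k) `^ (k.-1%:R^-1)) ^+ k.-1.
  by rewrite -powR_mulrn ?powR_ge0 // -powRrM mulVf // powRr1 // opnorm_ge0.
by rewrite lerXn2r // nnegrE ?powR_ge0 // /g le_max ler01.
Qed.

Lemma form_le_gamma k v : (2 <= k)%N ->
  hnorm (@F k v) <= g ^+ k.-1 * \prod_l hnorm (v l).
Proof.
move=> k2; apply: le_trans (hnorm_le_opnorm (Fform k) v) _.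
apply: ler_wpM2r; last exact: opnorm_le_gamma.
by apply: prodr_ge0 => l _; apply: hnorm_ge0.
Qed.

End Family.

End OperatorNorm.

(** * Normalized Taylor forms of the system *)

Section SymmetricDerivatives.
Variables (R : realType) (n : nat).
Local Notation C := R[i].
Local Notation normc := (@Normc.normc R).
Local Notation point := 'cV[C]_n.+1.
Variable x : point.

Definition dform (v : point) := linform (fun i => v i 0).

Lemma dform_linear a u v : dform (a *: u + v) = a *: dform u + dform v.
Proof.
rewrite /dform /linform scaler_sumr -big_split; apply: eq_bigr => i _ /=.
by rewrite !mxE scalerDl scalerA.
Qed.

(** The map D^k h(x) / k!, where k is the number of vectors. *)
Definition taylor_form h (l : seq point) : C^o :=
  (size l)`!%:R^-1 * pairing (fun i => x i 0) (\prod_(v <- l) dform v) h.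

Lemma taylor_form_multilinear h : multilinear (taylor_form h).
Proof.
move=> l1 l2 a u v; rewrite /taylor_form !size_cat /= !big_cat !big_cons /=.
rewrite dform_linear mulrDl mulrDr -scalerAl -scalerAr pairing_linear mulrDr.
by rewrite mulrCA.
Qed.

Lemma taylor_form_binomial h (t : C) e v m : taylor_form h (nseq m (t *: e + v)) =
  \sum_(r < m.+1) ('C(m, r)%:R * t ^+ r) *: taylor_form h (nseq r e ++ nseq (m - r) v).
Proof.
rewrite /taylor_form prod_nseq size_nseq dform_linear addrC exprDn.
under eq_bigr => r _ do rewrite -scaler_nat exprZn -scalerAr scalerA.
rewrite pairing_sum mulr_sumr; apply: eq_bigr => r _.
rewrite size_cat !size_nseq subnKC; last by rewrite -ltnS.
by rewrite big_cat /= !prod_nseq [dform e ^+ _ * _]mulrC [RHS]mulrCA.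
Qed.

Lemma taylor_form_Taylor h w N : (msize h <= N)%N ->
  evalp h (x + w) = \sum_(k < N) taylor_form h (nseq k w).
Proof.
move=> hN; rewrite /evalp (meval_eq (v2 := fun i => x i 0 + w i 0)); last first.
  by move=> i; rewrite mxE.
rewrite (Taylor_homogeneous _ _ hN); apply: eq_bigr => k _.
by rewrite /taylor_form size_nseq prod_nseq.
Qed.

Lemma taylor_form0 h : taylor_form h [::] = evalp h x.
Proof.
by rewrite /taylor_form big_nil -mpolyX0 pairingX mderivm0m fact0 invr1 mul1r.
Qed.

Lemma taylor_form1 h w : taylor_form h [:: w] = \sum_i w i 0 * evalp (h^`M(i)) x.
Proof.
rewrite /taylor_form big_seq1 /= invr1 mul1r /dform /linform pairing_sum.
by apply: eq_bigr => i _; rewrite pairingX mderivmU1m.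
Qed.

Lemma taylor_form_Dk p (g : system R n p) l :
  (size l)`!%:R^-1 *: Dk g x (fun i : 'I_(size l) => nth 0 l i) =
  \col_i taylor_form (g i) l.
Proof.
apply/matrixP => i j; rewrite !mxE /taylor_form; congr (_ * _).
rewrite [in RHS](big_nth 0) big_mkord.
by apply/esym; apply: (pairing_prod_linform _ _ (fun (k : 'I_(size l)) i => nth 0 l k i 0)).
Qed.

Lemma Dk_form p q (g : system R n p) k (G : 'M[C]_(q, p)) c :
  is_form (fun v : 'I_k -> point => G *m (c *: Dk g x v)).
Proof.
exists (fun j => G *m (c *: \col_i evalp ((g i)^`M[(\sum_(l < k) U_(j l))%MM]) x)) => v.
under [RHS]eq_bigr => j _ do rewrite !scalemxAr.
rewrite -mulmx_sumr; congr (_ *m _); apply/matrixP => i i'.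
rewrite !mxE summxE mulr_sumr; apply: eq_bigr => j _.
by rewrite !mxE mulrA mulrC.
Qed.

Lemma Dk_eq0 p (g : system R n p) k (v : 'I_k -> point) :
  (forall i, msize (g i) <= k)%N -> Dk g x v = 0.
Proof.
move=> gk; apply/matrixP => i i'; rewrite !mxE big1 // => j _.
rewrite mderivm_eq0; first by rewrite /evalp meval0 mul0r.
rewrite mdeg_sum (leq_trans (gk i)) //.
by under eq_bigr do rewrite mdeg1; rewrite sum_nat_const card_ord muln1.
Qed.

End SymmetricDerivatives.

Section Setup.
Variables (R : realType) (n : nat).
Local Notation C := R[i].
Local Notation normc := (@Normc.normc R).
Local Notation point := 'cV[C]_n.+1.
Variables (f : system R n n.+1) (x : point) (mu : nat).

Definition last_Delta := apply_functional (Delta f x mu) x (f ord_max).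
(** The inverse of Dhat, followed by the inclusion of the last n coordinates
    into the ambient space; with it the A_k take values where w lives. *)
Definition hat_inverse : 'M[C]_(n.+1, n) := col_mx (0 : 'M[C]_(1, n)) (invmx (Dhat f x)).
Definition hat_form (l : seq point) : point := hat_inverse *m \col_i taylor_form x (hatf f i) l.
Definition last_form (l : seq point) : C^o := last_Delta^-1 * taylor_form x (f ord_max) l.

Local Notation g := (gamma f x mu).

Lemma hatgamma_le : hatgamma f x <= g.
Proof. by rewrite /gamma le_max; apply/orP; left. Qed.

Lemma lastgamma_le : lastgamma f x mu <= g.
Proof. by rewrite /gamma le_max; apply/orP; right. Qed.

Lemma hatgamma_ge1 : 1 <= hatgamma f x.
Proof. by rewrite /hatgamma le_max; apply/orP; left. Qed.

Lemma lastgamma_ge1 : 1 <= lastgamma f x mu.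
Proof. by rewrite /lastgamma le_max; apply/orP; left. Qed.

Lemma gamma_ge1 : 1 <= g.
Proof. exact: le_trans hatgamma_ge1 hatgamma_le. Qed.

Lemma gamma_ge0 : 0 <= g. Proof. exact: le_trans gamma_ge1. Qed.

Lemma mul_hat_inverse (v : 'cV[C]_n) :
  hat_inverse *m v = col_mx (0 : 'cV[C]_1) (invmx (Dhat f x) *m v).
Proof.
have := mul_col_mx (0 : 'M[C]_(1, n)) (invmx (Dhat f x)) v.
by rewrite mul0mx.
Qed.

Lemma hat_form_multilinear : multilinear hat_form.
Proof.
move=> l1 l2 a u v; rewrite /hat_form scalemxAr -mulmxDr; congr (_ *m _).
by apply/matrixP => i j; rewrite !mxE taylor_form_multilinear.
Qed.

Lemma last_form_multilinear : multilinear last_form.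
Proof.
move=> l1 l2 a u v; rewrite /last_form taylor_form_multilinear mulrDr.
by rewrite -[_ *: taylor_form _ _ _]/(_ * _) mulrCA.
Qed.

Lemma hat_form_binomial (t : C) e v m : hat_form (nseq m (t *: e + v)) =
  \sum_(r < m.+1) ('C(m, r)%:R * t ^+ r) *: hat_form (nseq r e ++ nseq (m - r) v).
Proof.
rewrite /hat_form; under [RHS]eq_bigr do rewrite scalemxAr.
rewrite -mulmx_sumr; congr (_ *m _).
apply/matrixP => i j; rewrite mxE taylor_form_binomial summxE.
by apply: eq_bigr => r _; rewrite !mxE.
Qed.

Lemma last_form_binomial (t : C) e v m : last_form (nseq m (t *: e + v)) =
  \sum_(r < m.+1) ('C(m, r)%:R * t ^+ r) *: last_form (nseq r e ++ nseq (m - r) v).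
Proof.
rewrite /last_form taylor_form_binomial mulr_sumr; apply: eq_bigr => r _.
by rewrite -![_ *: _]/(_ * _) mulrCA.
Qed.

Lemma hat_form_bound l : (2 <= size l)%N ->
  hnorm (hat_form l) <= g ^+ (size l).-1 * \prod_(v <- l) hnorm v.
Proof.
move=> l2; rewrite /hat_form mul_hat_inverse hnorm_col_mx0 -taylor_form_Dk.
apply: le_trans (form_le_gamma (F := fun k (v : 'I_k -> point) =>
  invmx (Dhat f x) *m ((k`!)%:R^-1 *: Dk (hatf f) x v))
  (N := (\sum_i msize (f i))%N) _ _ (fun i : 'I_(size l) => nth 0 l i) l2) _.
- by move=> k; apply: Dk_form.
- move=> k v kN; rewrite Dk_eq0 ?scaler0 ?mulmx0 // => i.
  apply: leq_trans kN; rewrite (bigD1 (lift ord_max i)) //=; exact: leq_addr.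
rewrite (big_nth 0) big_mkord; apply: ler_wpM2r.
  by apply: prodr_ge0 => i _; exact: hnorm_ge0.
apply: lerXn2r; [|exact: gamma_ge0|exact: hatgamma_le].
exact: le_trans hatgamma_ge1.
Qed.

Lemma last_form_bound l : (2 <= size l)%N ->
  normc (last_form l) <= g ^+ (size l).-1 * \prod_(v <- l) hnorm v.
Proof.
move=> l2.
have -> : normc (last_form l) = hnorm (last_Delta^-1 *: ((size l)`!%:R^-1 *:
    Dk (lastf f) x (fun i : 'I_(size l) => nth 0 l i))).
  by rewrite hnorm_cV1 taylor_form_Dk !mxE.
apply: le_trans (form_le_gamma (F := fun k (v : 'I_k -> point) =>
  last_Delta^-1 *: ((k`!)%:R^-1 *: Dk (lastf f) x v))
  (N := msize (f ord_max)) _ _ (fun i : 'I_(size l) => nth 0 l i) l2) _.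
- move=> k; have [u Fu] := Dk_form x (lastf f) k (1%:M : 'M[C]_1) (last_Delta^-1 * k`!%:R^-1).
  by exists u => v; rewrite -Fu mul1mx scalerA.
- by move=> k v kN; rewrite Dk_eq0 ?scaler0.
rewrite (big_nth 0) big_mkord; apply: ler_wpM2r.
  by apply: prodr_ge0 => i _; exact: hnorm_ge0.
apply: lerXn2r; [|exact: gamma_ge0|exact: lastgamma_le].
exact: le_trans lastgamma_ge1.
Qed.

End Setup.

(** * Bounds on the eliminated forms and on Taylor remainders *)

Section ElimBound.
Variables (R : realType) (n : nat).
Local Notation C := R[i].
Local Notation normc := (@Normc.normc R).
Local Notation point := 'cV[C]_n.+1.
Variables (e : point) (A : seq point -> point) (B : seq point -> C^o) (g : R).
Hypotheses (g0 : 0 <= g) (e1 : hnorm e <= 1).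
Hypothesis bA : forall l, (2 <= size l)%N ->
  hnorm (A l) <= g ^+ (size l).-1 * \prod_(v <- l) hnorm v.
Hypothesis bB : forall l, (2 <= size l)%N ->
  normc (B l) <= g ^+ (size l).-1 * \prod_(v <- l) hnorm v.

Lemma prod_hnorm_ge0 (l : seq point) : 0 <= \prod_(v <- l) hnorm v.
Proof. by apply: prodr_ge0 => v _; apply: hnorm_ge0. Qed.

Lemma prod_hnorm_unit k l :
  \prod_(v <- nseq k e ++ l) hnorm v <= \prod_(v <- l) hnorm v.
Proof.
elim: k => //= k IH; rewrite big_cons -[X in _ <= X]mul1r.
by apply: ler_pM => //; [exact: hnorm_ge0 | exact: prod_hnorm_ge0].
Qed.

(** The exponent of g adds up because a substitution turns the degree
    i' + j' into i' + j' + m - 1, while the exponents are the degrees minus one. *)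
Lemma elim_rec_bound s i j l : (2 <= i + j)%N -> size l = j ->
  normc (elim_rec e A B s i j l) <=
  (c_rec s i j)%:R * (g ^+ (i + j).-1 * \prod_(v <- l) hnorm v).
Proof.
elim: s i j l => [|s IH] i j l ij2 lj /=; first by rewrite expr0n addr0 sqrtr0 mul0r.
rewrite natrD mulrDl; apply: le_trans (le_normcD _ _) _; rewrite normcN.
apply: lerD.
  rewrite Normc.normcM normc_nat; apply: ler_wpM2l => //.
  apply: le_trans (bB _) _; rewrite size_cat size_nseq lj //.
  by apply: ler_wpM2l; rewrite ?exprn_ge0 // prod_hnorm_unit.
rewrite natr_sum mulr_suml; apply: le_trans (normc_sum _ _ _) _.
apply: ler_sum => i' _.
rewrite natr_sum mulr_suml; apply: le_trans (normc_sum _ _ _) _.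
apply: ler_sum => j' /and3P[j'0 h1 h2].
rewrite Normc.normcM normc_nat mulnC natrM -mulrA; apply: ler_wpM2l => //.
have i'i := ltn_ord i'; have j'j := ltn_ord j'.
apply: le_trans (IH _ _ _ h1 _) _ => /=.
  by rewrite size_drop lj; lia.
apply: ler_wpM2l => //; rewrite big_cons.
apply: (@le_trans _ _ (g ^+ (i' + j').-1 *
   (g ^+ (i + j - (i' + j')) * \prod_(v <- l) hnorm v))); last first.
  by rewrite mulrA -exprD; have -> // : ((i' + j').-1 + (i + j - (i' + j')) = (i + j).-1)%N by lia.
apply: ler_wpM2l; first exact: exprn_ge0.
set k := (j.+1 - j')%N; rewrite -{3}(cat_take_drop k l) big_cat /= mulrA.
apply: ler_wpM2r; first exact: prod_hnorm_ge0.
have sz : size (nseq (i - i') e ++ take k l) = (i + j - (i' + j')).+1.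
  by rewrite size_cat size_nseq size_take lj; case: ltnP => ?; rewrite /k; lia.
apply: le_trans (bA _) _; first by rewrite sz; lia.
rewrite sz /=; apply: ler_wpM2l; first exact: exprn_ge0.
exact: prod_hnorm_unit.
Qed.

Lemma elim_form_bound i j (v : point) : (2 <= i + j)%N ->
  normc (elim_form e A B i j (nseq j v)) <=
  (c_coef i j)%:R * (g ^+ (i + j).-1 * hnorm v ^+ j).
Proof.
move=> ij; apply: le_trans (elim_rec_bound _ ij (size_nseq _ _)) _.
by rewrite prod_nseq.
Qed.

Lemma elim_form_bound_cons i j (u v : point) : (1 <= i + j)%N ->
  normc (elim_form e A B i j.+1 (u :: nseq j v)) <=
  (t_coef i j)%:R * (g ^+ (i + j) * (hnorm u * hnorm v ^+ j)).
Proof.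
move=> ij; rewrite /elim_form /t_coef /c_coef.
apply: le_trans (elim_rec_bound _ _ _) _; rewrite /= ?size_nseq ?addnS //.
by rewrite big_cons prod_nseq.
Qed.

End ElimBound.

(** Ratio at most 1/2: the sum is at most twice its first term. *)
Lemma geometric_tail (R : realFieldType) (g s : R) M N : 0 <= g -> 0 <= s ->
  g * s <= 1 / 2 -> (0 < M)%N ->
  \sum_(M <= k < N) g ^+ k.-1 * s ^+ k <= 2 * (g ^+ M.-1 * s ^+ M).
Proof.
move=> g0 s0 gs.
have t0 k : 0 <= g ^+ k.-1 * s ^+ k by rewrite mulr_ge0 ?exprn_ge0.
have [d] : exists d, (N - M = d)%N by exists (N - M)%N.
elim: d M => [|d IH] M dE M0.
  by rewrite big_geq ?mulr_ge0 ?exprn_ge0 //; lia.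
rewrite big_ltn; last by lia.
have := IH M.+1; rewrite /= => /(_ ltac:(lia) isT) h.
have : g ^+ M * s ^+ M.+1 = (g * s) * (g ^+ M.-1 * s ^+ M).
  by rewrite -{1}(prednK M0) !exprS; ring.
by have := t0 M; nra.
Qed.

(** * The eliminated last equation *)

Section Key.
Variables (R : realType) (n : nat).
Local Notation C := R[i].
Local Notation normc := (@Normc.normc R).
Local Notation point := 'cV[C]_n.+1.
Variables (f : system R n n.+1) (x : point) (mu : nat).
Hypotheses (mu2 : (2 <= mu)%N) (hnf : normalized_form f x) (fx : is_zero f x).

Local Notation g := (gamma f x mu).
Local Notation A := (hat_form f x).
Local Notation B := (last_form f x mu).
Let e : point := delta_mx ord0 0.
Let T := elim_form e A B.
Implicit Types w : point.

(** The vector v of the decomposition w = t e_1 + v. *)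
Definition hat_part (w : point) : point := w - w ord0 0 *: delta_mx ord0 0.
(** The value of hatf at x + w, normalized so that its linear part is v. *)
Definition hat_residual (w : point) : point :=
  hat_inverse f x *m \col_i evalp (hatf f i) (x + w).

Lemma hnorm_axis : hnorm e <= 1.
Proof.
rewrite /hnorm (bigD1 ord0) //= big1 ?addr0; last first.
  by move=> i i0; rewrite !mxE (negPf i0) Normc.normc0 expr0n.
by rewrite !mxE normc_nat !eqxx expr1n sqrtr1.
Qed.

Lemma head_hat_part w : w = w ord0 0 *: e + hat_part w.
Proof. by rewrite /hat_part addrC subrK. Qed.

Lemma hat_partE w : hat_part w = col_mx (0 : 'cV[C]_1) (\col_j w (lift ord0 j) 0).
Proof.
apply/matrixP => i j; rewrite ord1 !mxE; case: splitP => l /= il.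
  have -> : i = ord0 by apply: val_inj; rewrite /= il; case: l {il} => -[].
  by rewrite eqxx mulr1 subrr mxE.
have -> : i = lift ord0 l by apply: val_inj; rewrite /= il.
by rewrite mxE /= mulr0 subr0.
Qed.

Lemma hnorm_sqr_hat_part w : hnorm w ^+ 2 = normc (w ord0 0) ^+ 2 + hnorm (hat_part w) ^+ 2.
Proof.
rewrite hnorm_sqr_head hat_partE hnorm_col_mx0 hnorm_sqr; congr (_ + _).
by apply: eq_bigr => i _; rewrite mxE.
Qed.

Lemma Taylor_from_order2 h w N : (msize h <= N)%N -> (2 <= N)%N -> evalp h x = 0 ->
  evalp h (x + w) = \sum_i w i 0 * evalp (h^`M(i)) x +
    \sum_(2 <= k < N) taylor_form x h (nseq k w).
Proof.
move=> hN N2 hx; rewrite (taylor_form_Taylor _ _ hN).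
rewrite -(big_mkord xpredT (fun k => taylor_form x h (nseq k w))).
rewrite big_ltn; last exact: ltnW.
by rewrite big_ltn // taylor_form0 hx add0r taylor_form1.
Qed.

Lemma hat_residualE w N : (forall i, msize (f i) <= N)%N -> (2 <= N)%N ->
  hat_residual w = hat_part w + \sum_(2 <= k < N) A (nseq k w).
Proof.
move=> fN N2; have [col0 _ inv] := hnf; rewrite /hat_residual.
have -> : \col_i evalp (hatf f i) (x + w) =
    Dhat f x *m (\col_j w (lift ord0 j) 0) +
    \sum_(2 <= k < N) \col_i taylor_form x (hatf f i) (nseq k w).
  apply/matrixP => i i'; rewrite !mxE (Taylor_from_order2 _ (fN _)) //.
  rewrite summxE; congr (_ + _); last by apply: eq_bigr => k _; rewrite mxE.
  rewrite big_ord_recl; have := col0 (lift ord_max i); rewrite mxE => ->.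
  by rewrite mulr0 add0r; apply: eq_bigr => j _; rewrite !mxE mulrC.
rewrite mulmxDr mulmx_sumr; congr (_ + _).
by rewrite mul_hat_inverse mulmxA mulVmx // mul1mx hat_partE.
Qed.

Lemma last_form_expansion w N : (msize (f ord_max) <= N)%N -> (2 <= N)%N ->
  (last_Delta f x mu)^-1 * evalp (f ord_max) (x + w) = \sum_(2 <= k < N) B (nseq k w).
Proof.
move=> fN N2; rewrite (Taylor_from_order2 _ fN) //.
rewrite big1 ?add0r ?mulr_sumr // => i _.
by have [_ /(_ i) + _] := hnf; rewrite mxE => ->; rewrite mulr0.
Qed.

Lemma hat_form_remainder w M N : g * hnorm w <= 1 / 2 -> (1 < M)%N ->
  hnorm (\sum_(M <= k < N) A (nseq k w)) <= 2 * (g ^+ M.-1 * hnorm w ^+ M).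
Proof.
move=> gs M1; apply: le_trans (hnorm_sum _ _ _) _.
apply: le_trans _ (geometric_tail N (gamma_ge0 f x mu) (hnorm_ge0 w) gs (ltnW M1)).
rewrite !big_nat; apply: ler_sum => k /andP[Mk _].
have h : (2 <= size (nseq k w))%N by rewrite size_nseq; exact: leq_trans M1 Mk.
by apply: le_trans (hat_form_bound f x mu h) _; rewrite size_nseq prod_nseq.
Qed.

Lemma last_form_remainder w M N : g * hnorm w <= 1 / 2 -> (1 < M)%N ->
  normc (\sum_(M <= k < N) B (nseq k w)) <= 2 * (g ^+ M.-1 * hnorm w ^+ M).
Proof.
move=> gs M1; apply: le_trans (normc_sum _ _ _) _.
apply: le_trans _ (geometric_tail N (gamma_ge0 f x mu) (hnorm_ge0 w) gs (ltnW M1)).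
rewrite !big_nat; apply: ler_sum => k /andP[Mk _].
have h : (2 <= size (nseq k w))%N by rewrite size_nseq; exact: leq_trans M1 Mk.
by apply: le_trans (last_form_bound f x mu h) _; rewrite size_nseq prod_nseq.
Qed.

(** The elimination identity at x + w with the Taylor remainders estimated,
    whether or not this point is a zero: it serves both along the curve,
    where [hat_residual] is of order mu, and at a zero, where it is 0. *)
Lemma eliminated_bound w : let t := w ord0 0 in let s := hnorm w in
  g * s <= 1 / 2 ->
  normc (\sum_(2 <= k < mu.+1) t ^+ k * T k 0 [::] -
         (last_Delta f x mu)^-1 * evalp (f ord_max) (x + w)) <=
  \sum_(1 <= j < mu.+1) (c_coef (mu - j) j)%:R *
      (g ^+ mu.-1 * (normc t ^+ (mu - j) * hnorm (hat_part w) ^+ j)) +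
  2 * (g ^+ mu * s ^+ mu.+1) +
  \sum_(i < mu) \sum_(j < mu | (0 < i + j < mu.-1)%N)
     (t_coef i j)%:R * (normc t ^+ i * hnorm (hat_part w) ^+ j) *
     (g ^+ (i + j) * hnorm (hat_residual w) + 2 * (g ^+ mu * s ^+ (mu - (i + j)).+1)).
Proof.
move=> t s gs.
have g0 := gamma_ge0 f x mu; have s0 : 0 <= s := hnorm_ge0 w.
pose N := (mu.+1 + \sum_i msize (f i))%N.
have fN i : (msize (f i) <= N)%N.
  by rewrite /N (bigD1 i) //= addnCA leq_addr.
have N2 : (2 <= N)%N by rewrite /N; move: mu2; clear; lia.
have muN : (mu < N)%N by rewrite /N leq_addr.
rewrite (last_form_expansion _ (fN _) N2).
have := @elimination _ _ e A B (hat_form_multilinear f x) (last_form_multilinear f x mu)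
  t (hat_part w) (fun m => hat_form_binomial f x t e (hat_part w) m)
  (fun m => last_form_binomial f x mu t e (hat_part w) m) mu mu2.
rewrite -head_hat_part => /(canRL (addrK _)) ->.
rewrite (@big_cat_nat _ _ _ mu.+1 2 N) //=; last by apply: ltnW.
set S := \sum_(2 <= m < mu.+1) B _; set E := \sum_(i < mu) _.
set J := \sum_(1 <= j < mu.+1) _; set U := \sum_(mu.+1 <= m < N) _.
have -> : S - E - J - (S + U) = - (J + U + E).
  by move: (S : C) (E : C) (J : C) (U : C) => a b c d; ring.
have bA l : (2 <= size l)%N -> hnorm (A l) <= g ^+ (size l).-1 * \prod_(v <- l) hnorm v.
  exact: hat_form_bound.
have bB l : (2 <= size l)%N -> normc (B l) <= g ^+ (size l).-1 * \prod_(v <- l) hnorm v.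
  exact: last_form_bound.
rewrite normcN; apply: le_trans (le_normcD _ _) _; apply: lerD.
  apply: le_trans (le_normcD _ _) _; apply: lerD; last exact: (last_form_remainder N gs (leqW mu2)).
  apply: le_trans (normc_sum _ _ _) _; rewrite !big_nat; apply: ler_sum => j /andP[j1 jmu].
  have ij : (mu - j + j = mu)%N by rewrite subnK.
  rewrite Normc.normcM normcX.
  rewrite [X in _ <= X](_ : _ = normc t ^+ (mu - j) * ((c_coef (mu - j) j)%:R *
    (g ^+ (mu - j + j).-1 * hnorm (hat_part w) ^+ j))); last by rewrite ij; ring.
  apply: ler_wpM2l; first by rewrite exprn_ge0 ?normc_ge0.
  by apply: elim_form_bound; rewrite ?hnorm_axis ?ij.
apply: le_trans (normc_sum _ _ _) _; apply: ler_sum => i _.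
apply: le_trans (normc_sum _ _ _) _; apply: ler_sum => j /andP[ij1 ij2].
set M := (mu - (i + j))%N; set u := hat_part w + _.
have Mmu : (i + j + M = mu)%N by rewrite /M; move: ij1 ij2; clear; lia.
have uE : hnorm u <= hnorm (hat_residual w) + 2 * (g ^+ M * s ^+ M.+1).
  have -> : u = hat_residual w - \sum_(M.+1 <= k < N) A (nseq k w).
    rewrite (hat_residualE _ fN N2) (@big_cat_nat _ _ _ M.+1 2 N) /=.
    - by rewrite addrA addrK.
    - by rewrite /M; move: ij1 ij2; clear; lia.
    - by apply: leq_trans _ muN; rewrite ltnS /M leq_subr.
  have h := ler_hnormD (hat_residual w) (- \sum_(M.+1 <= k < N) A (nseq k w)).
  have h2 : (1 < M.+1)%N by rewrite /M; move: ij1 ij2; clear; lia.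
  have h3 := hat_form_remainder N gs h2; rewrite hnorm_opp in h.
  by apply: (le_trans h); rewrite lerD2l.
rewrite Normc.normcM normcX.
rewrite [X in _ <= X](_ : _ = normc t ^+ i * ((t_coef i j)%:R * (g ^+ (i + j) *
  ((hnorm (hat_residual w) + 2 * (g ^+ M * s ^+ M.+1)) * hnorm (hat_part w) ^+ j)))); last first.
  have -> : g ^+ mu = g ^+ (i + j) * g ^+ M by rewrite -exprD Mmu.
  by ring.
apply: ler_wpM2l; first by rewrite exprn_ge0 ?normc_ge0.
apply: le_trans (elim_form_bound_cons g0 hnorm_axis bA bB u (hat_part w) ij1) _.
apply: ler_wpM2l => //; apply: ler_wpM2l; first exact: exprn_ge0.
by apply: ler_wpM2r => //; rewrite exprn_ge0 ?hnorm_ge0.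
Qed.

End Key.

(** * Vanishing orders and the pure powers of the first coordinate *)

Section VanishingOrder.
Variable R : realType.
Local Notation C := R[i].
Local Notation normc := (@Normc.normc R).
Implicit Types (g h : C -> R) (m k : nat).

(** Order of vanishing at t = 0 for real functions of a complex variable, such
    as norms, as a bound on a disc; r <= 1 makes lower orders weaker. *)
Definition vanishes m g := exists K r, [/\ 0 <= K, 0 < r <= 1 &
  forall t, normc t <= r -> `|g t| <= K * normc t ^+ m].

Lemma vanishes_le m g h r0 : 0 < r0 ->
  (forall t, normc t <= r0 -> `|g t| <= `|h t|) -> vanishes m h -> vanishes m g.
Proof.
move=> r00 gh [K [r [K0 /andP[r1 r2] hK]]]; exists K, (Num.min r0 r); split=> //.
  by rewrite lt_min r00 r1 ge_min r2 orbT.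
move=> t; rewrite le_min => /andP[tr0 tr].
by apply: le_trans (gh _ tr0) _; apply: hK.
Qed.

Lemma vanishesW m m' g : (m' <= m)%N -> vanishes m g -> vanishes m' g.
Proof.
move=> mm [K [r [K0 r1 hK]]]; exists K, r; split=> // t tr.
apply: le_trans (hK _ tr) _; apply: ler_wpM2l => //.
apply: ler_wiXn2l => //; first exact: normc_ge0.
by case/andP: r1 => _; apply: le_trans.
Qed.

Lemma vanishesD m g h : vanishes m g -> vanishes m h ->
  vanishes m (fun t => g t + h t).
Proof.
move=> [K [r [K0 /andP[r0 r1] gK]]] [K' [r' [K'0 /andP[r'0 r'1] hK]]].
exists (K + K'), (Num.min r r'); split; first exact: addr_ge0.
  by rewrite lt_min r0 r'0 ge_min r1.
move=> t; rewrite le_min => /andP[tr tr'].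
apply: le_trans (ler_normD _ _) _; rewrite mulrDl.
by apply: lerD; [apply: gK | apply: hK].
Qed.

Lemma vanishesM m m' g h : vanishes m g -> vanishes m' h ->
  vanishes (m + m') (fun t => g t * h t).
Proof.
move=> [K [r [K0 /andP[r0 r1] gK]]] [K' [r' [K'0 /andP[r'0 r'1] hK]]].
exists (K * K'), (Num.min r r'); split; first exact: mulr_ge0.
  by rewrite lt_min r0 r'0 ge_min r1.
move=> t; rewrite le_min => /andP[tr tr'].
rewrite normrM exprD mulrACA.
by apply: ler_pM => //; [apply: gK | apply: hK].
Qed.

Lemma vanishes_cst c : vanishes 0 (fun=> c).
Proof.
exists `|c|, 1; split; rewrite ?normr_ge0 ?ltr01 ?lexx // => t _.
by rewrite expr0 mulr1.
Qed.

Lemma vanishesZ m c g : vanishes m g -> vanishes m (fun t => c * g t).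
Proof. exact: (vanishesM (vanishes_cst c)). Qed.

Lemma vanishes0 m : vanishes m (fun=> 0).
Proof.
exists 0, 1; split; rewrite ?ltr01 ?lexx // => t _.
by rewrite mul0r normr0.
Qed.

Lemma vanishes_ext m g h : g =1 h -> vanishes m g -> vanishes m h.
Proof. by move=> /funext ->. Qed.

Lemma vanishes_sum m I (r : seq I) (P : pred I) (g : I -> C -> R) :
  (forall i, P i -> vanishes m (g i)) ->
  vanishes m (fun t => \sum_(i <- r | P i) g i t).
Proof.
move=> gm; elim: r => [|i r IH].
  by apply: vanishes_ext (vanishes0 m) => t; rewrite big_nil.
case Pi: (P i).
  by apply: vanishes_ext (vanishesD (gm _ Pi) IH) => t; rewrite big_cons Pi.
by apply: vanishes_ext IH => t; rewrite big_cons Pi.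
Qed.

Lemma vanishesX m k g : vanishes m g -> vanishes (m * k) (fun t => g t ^+ k).
Proof.
move=> gm; elim: k => [|k IH].
  by rewrite muln0; apply: vanishes_ext (vanishes_cst 1) => t; rewrite expr0.
by rewrite mulnS; apply: vanishes_ext (vanishesM gm IH) => t; rewrite exprS.
Qed.

Lemma vanishes_normc : vanishes 1 normc.
Proof.
exists 1, 1; split; rewrite ?ltr01 ?lexx // => t _.
by rewrite mul1r expr1 ger0_norm ?normc_ge0.
Qed.

Lemma vanishes_poly m (P : {poly C}) : (forall k, (k < m)%N -> P`_k = 0) ->
  vanishes m (fun t => normc P.[t]).
Proof.
move=> P0; apply: (@vanishes_le _ _ (fun t => \sum_(k < size P) normc P`_k * normc t ^+ k) 1) => //.
  move=> t _; rewrite horner_coef ger0_norm ?normc_ge0 //.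
  apply: le_trans (normc_sum _ _ _) _; rewrite ger0_norm; last first.
    by apply: sumr_ge0 => k _; rewrite mulr_ge0 ?exprn_ge0 ?normc_ge0.
  by apply: ler_sum => k _; rewrite Normc.normcM normcX.
apply: vanishes_sum => k _; have [km|mk] := ltnP k m.
  by apply: vanishes_ext (vanishes0 m) => t; rewrite P0 // Normc.normc0 mul0r.
apply: (vanishesW mk); apply: vanishesZ.
by have := vanishesX k vanishes_normc; rewrite mul1n.
Qed.

Lemma vanishes_monomial m c : 0 <= c -> vanishes m.+1 (fun t => c * normc t ^+ m) -> c = 0.
Proof.
move=> c0 [K [r [K0 /andP[r0 r1] hK]]]; apply/eqP; rewrite eq_le c0 andbT leNgt.
apply/negP => c_gt0; pose a := Num.min r (c / (2 * (K + 1))).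
have K1 : 0 < K + 1 by rewrite ltr_wpDl.
have a0 : 0 < a by rewrite lt_min r0 divr_gt0 // mulr_gt0.
have ac : a * (2 * (K + 1)) <= c by rewrite -ler_pdivlMr ?mulr_gt0 // ge_min lexx orbT.
have := hK a%:C%C; rewrite normc_real ?(ltW a0) // ge_min lexx => /(_ isT).
rewrite ger0_norm ?mulr_ge0 ?exprn_ge0 ?(ltW a0) // exprS mulrA.
rewrite ler_pM2r ?exprn_gt0 // => cK; nra.
Qed.

(** The lowest non-zero coefficient would dominate near 0. *)
Lemma vanishes_poly_coef m (P : {poly C}) : vanishes m (fun t => normc P.[t]) ->
  forall k, (k < m)%N -> P`_k = 0.
Proof.
move=> Pm; elim/ltn_ind => k IH km; apply: Normc.eq0_normc.
pose Q := P - P`_k *: 'X^k.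
have Qk : vanishes k.+1 (fun t => normc Q.[t]).
  apply: vanishes_poly => j; rewrite ltnS leq_eqVlt coefB coefZ coefXn.
  move=> /orP[/eqP->|jk]; first by rewrite eqxx mulr1 subrr.
  by rewrite (ltn_eqF jk) mulr0 subr0 IH // (ltn_trans jk).
apply: (@vanishes_monomial k); first exact: normc_ge0.
apply: (@vanishes_le _ _ (fun t => normc P.[t] + normc Q.[t]) 1) => //; last first.
  by apply: vanishesD => //; apply: vanishesW Pm.
move=> t _; rewrite !ger0_norm ?addr_ge0 ?mulr_ge0 ?exprn_ge0 ?normc_ge0 //.
rewrite -normcX -Normc.normcM.
have -> : P`_k * t ^+ k = P.[t] - Q.[t].
  by rewrite /Q hornerD hornerN hornerZ hornerXn opprB addrC subrK.
by apply: le_trans (le_normcD _ _) _; rewrite normcN.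
Qed.

Lemma hnorm_le_sum p (v : 'cV[C]_p) : hnorm v <= \sum_i normc (v i 0).
Proof.
have s0 : 0 <= \sum_i normc (v i 0) by apply: sumr_ge0 => i _; exact: normc_ge0.
rewrite -ler_sqr ?nnegrE ?hnorm_ge0 // hnorm_sqr [X in _ <= X]expr2 mulr_suml.
apply: ler_sum => i _; rewrite expr2; apply: ler_wpM2l; first exact: normc_ge0.
by rewrite (bigD1 i) //= lerDl; apply: sumr_ge0 => j _; exact: normc_ge0.
Qed.

Lemma hnorm_mulmx p q (G : 'M[C]_(q, p)) : exists2 K, 0 <= K &
  forall u, hnorm (G *m u) <= K * \sum_i normc (u i 0).
Proof.
exists (\sum_i \sum_j normc (G i j)).
  by do 2![apply: sumr_ge0 => ? _]; exact: normc_ge0.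
move=> u; apply: le_trans (hnorm_le_sum _) _; rewrite mulr_suml.
apply: ler_sum => i _; rewrite mxE mulr_suml; apply: le_trans (normc_sum _ _ _) _.
apply: ler_sum => j _; rewrite Normc.normcM; apply: ler_wpM2l; first exact: normc_ge0.
by rewrite (bigD1 j) //= lerDl; apply: sumr_ge0 => ? _; exact: normc_ge0.
Qed.

End VanishingOrder.

Section CurveElimination.
Variables (R : realType) (n : nat).
Local Notation C := R[i].
Local Notation normc := (@Normc.normc R).
Local Notation point := 'cV[C]_n.+1.
Variables (f : system R n n.+1) (x : point) (mu : nat).
Hypotheses (mu2 : (2 <= mu)%N) (hnf : normalized_form f x).
Hypothesis hx : simple_multiple_zero f x mu.

Local Notation g := (gamma f x mu).
Local Notation w := (curve_point f x mu).
Let T := elim_form (delta_mx ord0 0) (hat_form f x) (last_form f x mu).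

Lemma vanishes_hnorm m p (v : C -> 'cV[C]_p) (P : 'I_p -> {poly C}) :
  (forall t i, v t i 0 = (P i).[t]) -> (forall i k, (k < m)%N -> (P i)`_k = 0) ->
  vanishes m (fun t => hnorm (v t)).
Proof.
move=> vP P0; apply: (@vanishes_le _ _ _ (fun t => \sum_i normc (P i).[t]) 1) => //.
  move=> t _; rewrite ger0_norm ?hnorm_ge0 // ger0_norm; last first.
    by apply: sumr_ge0 => i _; exact: normc_ge0.
  apply: le_trans (hnorm_le_sum _) _; apply: ler_sum => i _; by rewrite vP.
by apply: vanishes_sum => i _; apply: vanishes_poly; exact: P0.
Qed.

Lemma vanishes_curve : vanishes 1 (fun t => hnorm (w t)).
Proof.
apply: (@vanishes_hnorm _ _ _ (curve f x mu)) => [t i|i [|//] _]; first by rewrite mxE.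
by rewrite coef_curve.
Qed.

(** The curve is tangent to the first axis: a_(1,s) = 0 for s >= 2. *)
Lemma vanishes_hat_part_curve : vanishes 2 (fun t => hnorm (hat_part (w t))).
Proof.
apply: (@vanishes_hnorm _ _ _ (fun i => curve f x mu i * (i != ord0)%:R)).
  move=> t i; rewrite /hat_part !mxE eqxx andbT.
  have [->|i0] := eqVneq i ord0; first by rewrite mulr1 subrr mulr0 horner0.
  by rewrite mulr0 subr0 mulr1.
move=> i k k2; have [->|i0] := eqVneq i ord0; first by rewrite mulr0 coef0.
rewrite mulr1 coef_curve; case: k k2 => [|[|//]] // _.
by rewrite coefa1 mxE (negPf i0) if_same.
Qed.

Lemma vanishes_hat_residual_curve : vanishes mu (fun t => hnorm (hat_residual f x (w t))).
Proof.
have fx : is_zero f x by case: hx.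
have [P hP] := choice (fun i => hatf_on_curve hnf i mu2 fx).
have [K K0 hK] := hnorm_mulmx (hat_inverse f x).
apply: (@vanishes_le _ _ _ (fun t => K * \sum_i normc (P i).[t]) 1) => //.
  move=> t _; rewrite ger0_norm ?hnorm_ge0 // ger0_norm; last first.
    by rewrite mulr_ge0 // sumr_ge0 // => i _; exact: normc_ge0.
  apply: le_trans (hK _) _; apply: ler_wpM2l => //.
  by apply: ler_sum => i _; rewrite mxE (proj1 (hP i)).
apply: vanishesZ; apply: vanishes_sum => i _; apply: vanishes_poly.
exact: (proj2 (hP i)).
Qed.

Lemma small_curve : exists2 r, 0 < r & forall t, normc t <= r -> g * hnorm (w t) <= 1 / 2.
Proof.
have [K [r [K0 /andP[r0 r1] hK]]] := vanishes_curve.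
have g1 : 0 < g by apply: lt_le_trans (gamma_ge1 f x mu).
have c0 : 0 < 2 * (g * (K + 1)) by rewrite !mulr_gt0 // ltr_wpDl.
(* The radius makes g K |t| at most 1/2; K + 1 avoids a division by 0. *)
exists (Num.min r (2 * (g * (K + 1)))^-1); first by rewrite lt_min r0 invr_gt0.
move=> t; rewrite le_min => /andP[tr tc].
have h := hK t tr; rewrite ger0_norm ?hnorm_ge0 // expr1 in h.
have t0 := normc_ge0 t.
have tc1 : normc t * (2 * (g * (K + 1))) <= 1 by rewrite -ler_pdivlMr // div1r.
have gh : g * hnorm (w t) <= g * (K * normc t) by rewrite ler_pM2l.
have gt0 : 0 <= g * normc t by rewrite mulr_ge0 ?(ltW g1).
nra.
Qed.

(** On the curve v is O(t^2), so every term with j > 0 of the eliminated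
    equation is O(t^(mu+1)), as are the remainders; hence the polynomial
    sum_k T_(k,0) t^k agrees with f_n / Delta_mu(f_n) = t^mu + O(t^(mu+1)) up to
    degree mu. *)
Lemma elim_form_on_axis :
  (forall k, (2 <= k < mu)%N -> T k 0 [::] = 0) /\ T mu 0 [::] = 1.
Proof.
have fx : is_zero f x by case: hx.
have [P [PE P0 PD]] := lastf_on_curve hnf mu2 hx.
pose Q : {poly C} := \sum_(2 <= k < mu.+1) (T k 0 [::] : C) *: 'X^k - (last_Delta f x mu)^-1 *: P.
have QE t : Q.[t] = \sum_(2 <= k < mu.+1) t ^+ k * T k 0 [::] -
    (last_Delta f x mu)^-1 * evalp (f ord_max) (x + w t).
  rewrite /Q hornerD hornerN hornerZ PE horner_sum; congr (_ - _).
  by apply: eq_bigr => k _; rewrite hornerZ hornerXn mulrC.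
have [r r0 hr] := small_curve.
have Qv : vanishes mu.+1 (fun t => normc Q.[t]).
  apply: (@vanishes_le _ _ _ (fun t =>
    \sum_(1 <= j < mu.+1) (c_coef (mu - j) j)%:R *
      (g ^+ mu.-1 * (normc t ^+ (mu - j) * hnorm (hat_part (w t)) ^+ j)) +
    2 * (g ^+ mu * hnorm (w t) ^+ mu.+1) +
    \sum_(i < mu) \sum_(j < mu | (0 < i + j < mu.-1)%N)
     (t_coef i j)%:R * (normc t ^+ i * hnorm (hat_part (w t)) ^+ j) *
     (g ^+ (i + j) * hnorm (hat_residual f x (w t)) +
      2 * (g ^+ mu * hnorm (w t) ^+ (mu - (i + j)).+1))) r) => //.
    move=> t tr; rewrite ger0_norm ?normc_ge0 //.
    apply: le_trans (ler_norm _); rewrite QE.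
    have := eliminated_bound mu2 hnf fx (hr t tr).
    by rewrite curve_point0.
  have X1 k : vanishes k (fun t => normc t ^+ k).
    by have := vanishesX k (@vanishes_normc R); rewrite mul1n.
  have X2 k : vanishes k (fun t => hnorm (w t) ^+ k).
    by have := vanishesX k vanishes_curve; rewrite mul1n.
  have X3 k := vanishesX k vanishes_hat_part_curve.
  apply: vanishesD; first apply: vanishesD.
  - rewrite /index_iota; under eq_fun do rewrite big_seq.
    apply: vanishes_sum => j; rewrite mem_iota => j1.
    apply: vanishesZ; apply: vanishesZ.
    apply: vanishesW (vanishesM (X1 (mu - j)%N) (X3 j)).
    by move: j1; clear; lia.
  - by apply: vanishesZ; apply: vanishesZ; exact: X2.
  apply: vanishes_sum => i _; apply: vanishes_sum => j /andP[ij1 ij2].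
  (* At least t^i v^j = O(t^(i + 2 j)) times the order of the Taylor remainder. *)
  apply: (@vanishesW _ (i + 2 * j + (mu - (i + j)).+1)).
    by move: ij1 ij2; clear; lia.
  apply: vanishesM; first by apply: vanishesZ; exact: vanishesM.
  apply: vanishesD; last by apply: vanishesZ; apply: vanishesZ; exact: X2.
  apply: vanishesZ; apply: vanishesW vanishes_hat_residual_curve.
  by move: ij1 ij2; clear; lia.
have Q0 := vanishes_poly_coef Qv.
have coefQ k : (2 <= k <= mu)%N -> T k 0 [::] = (last_Delta f x mu)^-1 * P`_k.
  move=> /andP[k2 kmu]; have /eqP := Q0 k kmu.
  rewrite coefB coefZ coef_sum subr_eq0 => /eqP <-.
  rewrite (bigD1_seq k) ?mem_index_iota ?iota_uniq ?k2 ?ltnS //=.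
  rewrite coefZ coefXn eqxx mulr1 big1 ?addr0 // => j jk.
  by rewrite coefZ coefXn eq_sym (negPf jk) mulr0.
split=> [k /andP[k2 kmu]|].
  by rewrite coefQ ?k2 ?(ltnW kmu) // P0 // mulr0.
rewrite coefQ ?mu2 ?leqnn // PD mulVf //; by case: hx.
Qed.

End CurveElimination.

(** * The constant d *)

Section SmallestRoot.
Variables (R : realType) (p : R -> R).
Hypotheses (cp : continuous p) (p0 : 0 < p 0) (p1 : p 1 < 0).

Lemma ivt_root a : 0 <= a -> p a < 0 -> exists2 r, 0 < r < a & p r = 0.
Proof.
move=> a0 pa; have [] := @IVT R p 0 a 0 a0.
- exact: continuous_subspaceT.
- by rewrite ge_min le_max (ltW p0) (ltW pa) orbT.
move=> r; rewrite in_itv /= => /andP[r0 ra] pr; exists r => //.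
rewrite !lt_neqAle r0 ra !andbT; apply/andP; split; apply/eqP => e.
  by move: p0; rewrite [X in p X]e pr ltxx.
by move: pa; rewrite -e pr ltxx.
Qed.

(** The infimum of the roots is a root by continuity; before it p keeps the
    sign of p(0), by the intermediate value theorem. *)
Lemma smallest_root : exists z, [/\ 0 < z <= 1, p z = 0,
  forall r, 0 < r <= 1 -> p r = 0 -> z <= r & forall r, 0 <= r <= z -> 0 <= p r].
Proof.
pose S := [set r : R | 0 < r <= 1 /\ p r = 0]%classic.
have hS : has_inf S.
  split; last by exists 0 => r [/andP[/ltW]].
  by have [r /andP[r0 r1] pr] := ivt_root ler01 p1; exists r; rewrite /S /= r0 ltW.
have lbS : lbound S (inf S) by apply: ge_inf; case: hS.
pose z := inf S.
have z0 : 0 <= z by apply: lb_le_inf; [case: hS | move=> r [/andP[/ltW]]].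
have pz : p z = 0.
  apply: contrapT => /eqP pz.
  have /nbhs_ballP[e /= e0 he] : \forall t \near z, p t != 0.
    exact: (cvgr_neq0 (p z) (@cp z) pz).
  have [r Sr re] := inf_adherent e0 hS; have zr := lbS _ Sr.
  case: Sr => _ pr; have : p r != 0; last by rewrite pr eqxx.
  apply: he.
  rewrite -ball_normE /= distrC ger0_norm ?subr_ge0 //.
  by rewrite ltrBlDl.
have z_gt0 : 0 < z.
  by rewrite lt_neqAle z0 andbT; apply/eqP => e; move: p0; rewrite [X in p X]e pz ltxx.
have zmin r : 0 < r <= 1 -> p r = 0 -> z <= r by move=> r1 pr; apply: lbS.
have z1 : z <= 1.
  have [r /andP[r0 r1] pr] := ivt_root ler01 p1.
  by apply: (le_trans _ (ltW r1)); apply: zmin => //; rewrite r0 ltW.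
exists z; split => //; first by rewrite z_gt0.
move=> r /andP[r0 rz]; rewrite leNgt; apply/negP => pr.
have [s /andP[s0 sr] ps] := ivt_root r0 pr.
have := zmin s; rewrite s0 ps (le_trans (ltW sr)) ?(le_trans rz) // => /(_ erefl erefl).
by rewrite leNgt (lt_le_trans sr rz).
Qed.

End SmallestRoot.

Section Constant.
Variables (R : realType) (mu : nat).
Hypothesis mu2 : (2 <= mu)%N.

Lemma pd_continuous : continuous (@pd R mu).
Proof.
have cid : continuous (@id R) by move=> x; exact: cvg_id.
have cX (g : R -> R) k : continuous g -> continuous (fun x => g x ^+ k).
  move=> cg x; apply: (@continuous_comp _ _ _ g (fun y => y ^+ k)); [exact: cg | exact: exprn_continuous].
have cq : continuous (fun d : R => Num.sqrt (1 - d ^+ 2)).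
  move=> x; apply: (@continuous_comp _ _ _ (fun d : R => 1 - d ^+ 2)); last exact: sqrt_continuous.
  by apply: continuousB; [exact: cst_continuous | exact: cX].
have cS := continuous_big (@add_continuous R).
have cM (g h : R -> R) : continuous g -> continuous h -> continuous (fun x => g x * h x).
  by move=> cg ch x; apply: continuousM; [exact: cg | exact: ch].
have cD (g h : R -> R) : continuous g -> continuous h -> continuous (fun x => g x + h x).
  by move=> cg ch x; apply: continuousD; [exact: cg | exact: ch].
have cN (g : R -> R) : continuous g -> continuous (fun x => - g x).
  by move=> cg x; apply: continuousN; exact: cg.
have cC (c : R) : continuous (fun _ : R => c) by exact: cst_continuous.
rewrite /pd /=; apply: (cD); first apply: (cD); first exact: cX.
  apply: (cN); apply: (cS) => j _; apply: (cM); last exact: cX.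
  by apply: (cM); last exact: cX; apply: (cM).
apply: (cN); apply: (cM) => //; apply: (cD) => //; apply: (cD) => //.
apply: (cS) => i _; apply: (cS) => j _; apply: (cM); last exact: cX.
by apply: (cM); last exact: cX.
Qed.

Lemma pd0 : @pd R mu 0 = 1.
Proof.
rewrite /pd expr0n subr0 sqrtr1 expr1n mul0r subr0 big1 ?subr0 //.
by move=> j _; rewrite mulr0 !mul0r.
Qed.

Lemma pd1 : @pd R mu 1 < 0.
Proof.
rewrite /pd expr1n subrr sqrtr0 expr0n gtn_eqF; last by apply: ltnW.
rewrite sub0r mul1r.
have h1 : 0 <= \sum_(1 <= j < mu.+1)
    (c_coef (mu - j) j)%:R * 1 * 0 ^+ (mu - j) * 1 ^+ j.-1 :> R.
  by apply: sumr_ge0 => j _; rewrite !mulr_ge0 ?exprn_ge0.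
have h2 : 0 <= \sum_(1 <= i < mu.-1) (t_coef i 0)%:R :> R by apply: sumr_ge0.
have h3 : 0 <= \sum_(0 <= i < mu.-1) \sum_(1 <= j < mu.-1 | (i + j <= mu - 2)%N)
             (t_coef i j)%:R * 0 ^+ i * 1 ^+ j :> R.
  by apply: sumr_ge0 => i _; apply: sumr_ge0 => j _; rewrite !mulr_ge0 ?exprn_ge0.
lra.
Qed.

Lemma d3P : 0 < d3 R mu <= 1 /\ forall r, 0 <= r <= d3 R mu -> 0 <= @pd R mu r.
Proof.
have [z [z01 pz zmin zge]] := smallest_root pd_continuous
  (ltac:(by rewrite pd0) : 0 < @pd R mu 0) pd1.
suff -> : d3 R mu = z by [].
rewrite /d3; apply: xget_unique; first by split=> // s [s01 ps]; apply: zmin.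
move=> y [[y01 py] ymin]; apply/eqP; rewrite eq_le; apply/andP; split.
  by apply: ymin.
exact: zmin.
Qed.

Lemma dconst_gt0 : 0 < dconst R mu.
Proof.
rewrite /dconst !lt_min /d1 /d2 !sqrtr_gt0 !divr_gt0 //=.
- by case: d3P => /andP[].
- by rewrite ltr0n; lia.
by rewrite ltr_wpDl ?sqr_ge0.
Qed.

Lemma dconst_le : let d := dconst R mu in
  [/\ d <= d1 R mu, d <= d2 R mu, d <= d3 R mu & 0 <= @pd R mu d].
Proof.
have [d1d d2d d3d] : [/\ dconst R mu <= d1 R mu, dconst R mu <= d2 R mu &
   dconst R mu <= d3 R mu].
  by split; rewrite /dconst !ge_min lexx ?orbT.
by split => //; apply: (proj2 d3P); rewrite ltW ?dconst_gt0.
Qed.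

End Constant.

(** * The inequality between real numbers *)

(** Separates the terms with j = 0, for which the cosine is bounded by 1
    instead of sqrt(1 - d^2). *)
Lemma split_first_column (M : nmodType) mu (F : nat -> nat -> M) : (2 <= mu)%N ->
  \sum_(i < mu) \sum_(j < mu | (0 < i + j < mu.-1)%N) F i j =
  \sum_(1 <= i < mu.-1) F i 0%N +
  \sum_(0 <= i < mu.-1) \sum_(1 <= j < mu.-1 | (i + j <= mu - 2)%N) F i j.
Proof.
case: mu => [|[|m]] // _; rewrite /= subSS subn1 /=.
pose G i := (if (0 < i < m.+1)%N then F i 0%N else 0) +
  \sum_(1 <= j < m.+1 | (i + j <= m)%N) F i j.
rewrite (eq_bigr (fun i : 'I_m.+2 => G i)) => [|i _]; last first.
  rewrite big_mkcond big_ord_recl /= addn0 /G; congr (_ + _).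
  rewrite -big_mkcond big_add1 big_mkord /=.
  apply: (sum_ord_change (P := fun j => (0 < i + j.+1 < m.+1)%N)
    (Q := fun j => (i + j.+1 <= m)%N) (fun j => F i j.+1)) => j.
  by clear; lia.
rewrite big_ord_recr /= [X in _ + X](_ : _ = 0); last first.
  rewrite /G ltnn andbF add0r big_nat_cond big1 // => j.
  by move=> /andP[/andP[j1 _]]; move: j1; clear; lia.
rewrite addr0 -(big_mkord xpredT G) /G big_split /=; congr (_ + _).
rewrite big_ltn // ltnn add0r; apply: eq_big_nat => i /andP[i1 im].
by rewrite i1 im.
Qed.

Section Numeric.
Variables (R : realType) (mu : nat).
Hypothesis mu2 : (2 <= mu)%N.

(** Mean value bound for the power function. *)
Lemma sub_pow_le (a b : R) i : 0 <= b -> b <= a ->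
  a ^+ i.+1 - b ^+ i.+1 <= i.+1%:R * a ^+ i * (a - b).
Proof.
move=> b0 ba; have a0 := le_trans b0 ba; elim: i => [|i IH].
  by rewrite !expr1 expr0 !mul1r.
have ai : b ^+ i.+1 <= a ^+ i.+1 by apply: lerXn2r; rewrite ?nnegrE.
have h : a * (a ^+ i.+1 - b ^+ i.+1) <= a * (i.+1%:R * a ^+ i * (a - b)).
  exact: ler_wpM2l.
have h2 : b ^+ i.+1 * (a - b) <= a ^+ i.+1 * (a - b).
  by apply: ler_wpM2r; rewrite ?subr_ge0.
have -> : a ^+ i.+2 - b ^+ i.+2 = a * (a ^+ i.+1 - b ^+ i.+1) + b ^+ i.+1 * (a - b).
  by rewrite !exprS; ring.
apply: le_trans (lerD h h2) _.
by rewrite le_eqVlt; apply/orP; left; apply/eqP; rewrite -[in RHS]natr1 exprS; ring.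
Qed.

(** The function (1 - z)^i z increases on [0, 1/(i+1)]. *)
Lemma pow_mul_le (z Z : R) i : 0 <= z -> z <= Z -> Z * i.+1%:R <= 1 ->
  (1 - z) ^+ i * z <= (1 - Z) ^+ i * Z.
Proof.
move=> z0 zZ Zi; case: i Zi => [|i] Zi; first by rewrite !expr0 !mul1r.
have Z0 := le_trans z0 zZ.
have iZ : i.+1%:R * Z <= 1 - Z.
  by move: Zi; rewrite -natr1; nra.
have Z1 : 0 <= 1 - Z by apply: le_trans iZ; rewrite mulr_ge0.
have zz : 1 - Z <= 1 - z by lra.
have h := sub_pow_le i Z1 zz.
have ai0 : 0 <= (1 - z) ^+ i by apply: exprn_ge0; lra.
have eq1 : 1 - z - (1 - Z) = Z - z by ring.
rewrite eq1 in h.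
have h1 : Z * ((1 - z) ^+ i.+1 - (1 - Z) ^+ i.+1) <=
    Z * (i.+1%:R * (1 - z) ^+ i * (Z - z)) by apply: ler_wpM2l.
have h2 : (i.+1%:R * Z) * ((1 - z) ^+ i * (Z - z)) <= (1 - z) * ((1 - z) ^+ i * (Z - z)).
  by apply: ler_wpM2r; [rewrite mulr_ge0 ?subr_ge0 | apply: le_trans zz].
have h3 : (1 - z) * ((1 - z) ^+ i * (Z - z)) = (1 - z) ^+ i.+1 * Z - (1 - z) ^+ i.+1 * z.
  by rewrite exprS; ring.
have h4 : Z * (i.+1%:R * (1 - z) ^+ i * (Z - z)) = (i.+1%:R * Z) * ((1 - z) ^+ i * (Z - z)).
  by ring.
move: h1 h2; rewrite h3 h4.
move: (_ * Z * _) => u; move: ((1 - z) ^+ i.+1) ((1 - Z) ^+ i.+1) => a b.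
by nra.
Qed.

Variables (d Cc S delta G : R).
Let q := Num.sqrt (1 - d ^+ 2).
Hypotheses (d0 : 0 < d) (dd1 : d <= d1 R mu) (dd2 : d <= d2 R mu).
Hypotheses (pd_ge0 : 0 <= pd mu d).
Hypotheses (C0 : 0 <= Cc) (S0 : 0 <= S) (CS : Cc ^+ 2 + S ^+ 2 = 1).
Hypotheses (G1 : 1 <= G) (GS : G * S <= delta) (deltad : delta < d).

Lemma sqr_d_le : d ^+ 2 * (mu.-1)%:R <= 1.
Proof.
have m0 : 0 < (mu.-1)%:R :> R by rewrite ltr0n; move: mu2; clear; lia.
rewrite -ler_pdivlMr //.
by rewrite -(@sqr_sqrtr _ (1 / mu.-1%:R)) ?divr_ge0 // ler_sqr ?nnegrE ?sqrtr_ge0 // ltW.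
Qed.

Lemma d_le1 : d ^+ 2 <= 1.
Proof.
have m1 : 1 <= (mu.-1)%:R :> R by rewrite ler1n; move: mu2; clear; lia.
have := sqr_d_le; have := sqr_ge0 d; nra.
Qed.

Lemma q_ge0 : 0 <= q. Proof. exact: sqrtr_ge0. Qed.
Lemma sqr_q : q ^+ 2 = 1 - d ^+ 2.
Proof. by rewrite sqr_sqrtr // subr_ge0 d_le1. Qed.

Lemma S_le_d : S <= d.
Proof. by apply: le_trans (ltW deltad); apply: le_trans GS; rewrite ler_peMl. Qed.

Lemma q_le_C : q <= Cc.
Proof.
rewrite -ler_sqr ?nnegrE ?q_ge0 // sqr_q.
have : S ^+ 2 <= d ^+ 2 by rewrite ler_sqr ?nnegrE ?S_le_d // ltW.
by move: CS; lra.
Qed.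

Lemma C_le1 : Cc <= 1.
Proof. by rewrite -(@ler_sqr _ Cc 1) ?nnegrE // expr1n -CS lerDl sqr_ge0. Qed.

(** This is where d <= d_1 enters. *)
Lemma q_ge_cd : (c_coef mu.-1 1)%:R * d <= q.
Proof.
set c : R := (c_coef mu.-1 1)%:R.
have c0 : 0 <= c by [].
have c1 : 0 < c ^+ 2 + 1 by rewrite ltr_wpDl ?sqr_ge0.
have h : d ^+ 2 * (c ^+ 2 + 1) <= 1.
  rewrite -ler_pdivlMr // -(@sqr_sqrtr _ (1 / _)) ?divr_ge0 ?(ltW c1) //.
  by rewrite ler_sqr ?nnegrE ?sqrtr_ge0 // ltW.
rewrite -ler_sqr ?nnegrE ?q_ge0 ?mulr_ge0 ?(ltW d0) // sqr_q exprMn.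
by move: h; move: (d ^+ 2) (c ^+ 2) => *; lra.
Qed.

(** This is where d <= d_2 enters: c^i s^j = (1 - s^2)^(i/2) s^j increases with
    the sine s as long as s^2 (i + 1) <= 1; powers of s beyond the first only
    help. *)
Lemma cos_sin_monotone i j : (0 < j)%N -> (i + j <= mu.-1)%N ->
  Cc ^+ i * S ^+ j <= q ^+ i * d ^+ j.
Proof.
case: j => // j _ ij; rewrite exprS [d ^+ j.+1]exprS !mulrA.
apply: ler_pM; rewrite ?mulr_ge0 ?exprn_ge0 //; last first.
  by apply: lerXn2r; rewrite ?nnegrE ?S_le_d // ltW.
rewrite -ler_sqr ?nnegrE ?mulr_ge0 ?exprn_ge0 ?q_ge0 ?(ltW d0) //.
have sw (a : R) : a ^+ i ^+ 2 = a ^+ 2 ^+ i by rewrite -!exprM mulnC.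
rewrite !exprMn !sw. rewrite sqr_q.
have -> : Cc ^+ 2 = 1 - S ^+ 2 by move: CS; lra.
apply: pow_mul_le; first exact: sqr_ge0.
  by rewrite ler_sqr ?nnegrE ?S_le_d // ltW.
apply: le_trans sqr_d_le; apply: ler_wpM2l; first exact: sqr_ge0.
by rewrite ler_nat; move: ij; clear; lia.
Qed.

(** [Cc] and [S] are the cosine and sine of the angle between w and the first
    axis, [G] is g^(mu-1) and [delta] is 2 g^mu s.  The term with j = 1 is
    treated together with the leading one, as c^(mu-1) (c - c_(mu-1,1) d), a
    product of non-negative factors increasing in c.  Strictness comes from
    the last term, where delta < d is multiplied by a number at least 1. *)
Lemma angular_inequality :
  \sum_(1 <= j < mu.+1) (c_coef (mu - j) j)%:R * (G * (Cc ^+ (mu - j) * S ^+ j)) +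
  delta * (1 + \sum_(i < mu) \sum_(j < mu | (0 < i + j < mu.-1)%N)
     (t_coef i j)%:R * (Cc ^+ i * S ^+ j)) < Cc ^+ mu.
Proof.
pose E := \sum_(1 <= i < mu.-1) (t_coef i 0)%:R
         + \sum_(0 <= i < mu.-1) \sum_(1 <= j < mu.-1 | (i + j <= mu - 2)%N)
             (t_coef i j)%:R * q ^+ i * d ^+ j :> R.
have q0 := q_ge0; have d0' := ltW d0.
have E0 : 0 <= E.
  by apply: addr_ge0; do ?[apply: sumr_ge0 => ? _]; rewrite ?mulr_ge0 ?exprn_ge0.
have delta0 : 0 <= delta by apply: le_trans GS; rewrite mulr_ge0 // (le_trans ler01).
have hE : \sum_(i < mu) \sum_(j < mu | (0 < i + j < mu.-1)%N)
     (t_coef i j)%:R * (Cc ^+ i * S ^+ j) <= E.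
  rewrite (split_first_column (fun i j => (t_coef i j)%:R * (Cc ^+ i * S ^+ j))) //.
  apply: lerD; rewrite ?big_nat; apply: ler_sum => i ib.
    by rewrite expr0 mulr1 ler_piMr // exprn_ile1 ?C_le1.
  rewrite big_nat_cond [X in _ <= X]big_nat_cond; apply: ler_sum => j jb.
  rewrite -mulrA; apply: ler_wpM2l => //; apply: cos_sin_monotone.
    by move: jb; clear; lia.
  by move: jb; clear; lia.
pose J := \sum_(2 <= j < mu.+1) (c_coef (mu - j) j)%:R * d * q ^+ (mu - j) * d ^+ j.-1 : R.
have hJ : \sum_(2 <= j < mu.+1) (c_coef (mu - j) j)%:R * (G * (Cc ^+ (mu - j) * S ^+ j)) <= J.
  rewrite big_nat [X in _ <= X]big_nat; apply: ler_sum => j /andP[j2 jmu].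
  have -> : S ^+ j = S * S ^+ j.-1 by rewrite -exprS prednK // ltnW.
  have -> : G * (Cc ^+ (mu - j) * (S * S ^+ j.-1)) = (G * S) * (Cc ^+ (mu - j) * S ^+ j.-1).
    by ring.
  rewrite -[X in _ <= X]mulrA -[X in _ <= X]mulrA; apply: ler_wpM2l => //; apply: ler_pM.
  - by rewrite mulr_ge0 // (le_trans ler01).
  - by rewrite mulr_ge0 ?exprn_ge0.
  - exact: le_trans GS (ltW deltad).
  - by apply: cos_sin_monotone; move: j2 jmu; clear; lia.
have pdE : pd mu d = q ^+ mu - ((c_coef mu.-1 1)%:R * d * q ^+ mu.-1 + J) - d * (E + 1).
  rewrite /pd -/q -/E (big_ltn (leqW mu2)) /=.
  by rewrite subn1 expr0 mulr1.
rewrite (big_ltn (leqW mu2)) subn1.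
set c : R := (c_coef mu.-1 1)%:R in pdE *.
have h1 : c * (G * (Cc ^+ mu.-1 * S ^+ 1)) <= c * (d * Cc ^+ mu.-1).
  apply: ler_wpM2l; first by rewrite /c.
  rewrite expr1.
  rewrite [X in X <= _](_ : _ = (G * S) * Cc ^+ mu.-1); last by ring.
  apply: ler_wpM2r; first exact: exprn_ge0.
  exact: le_trans GS (ltW deltad).
have h2 : q ^+ mu.-1 * (q - c * d) <= Cc ^+ mu.-1 * (Cc - c * d).
  apply: ler_pM; rewrite ?exprn_ge0 ?subr_ge0 ?q_ge_cd ?lerD2r ?q_le_C //.
  by apply: lerXn2r; rewrite ?nnegrE ?q_le_C.
have e1 : Cc ^+ mu = Cc ^+ mu.-1 * Cc by rewrite -exprSr prednK // ltnW.
have e2 : q ^+ mu = q ^+ mu.-1 * q by rewrite -exprSr prednK // ltnW.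
move: hE; set E' := \sum_(i < mu) _ => hE.
have h3 : delta * (1 + E') <= delta * (1 + E) by apply: ler_wpM2l; rewrite ?lerD2l.
have h4 : delta * (1 + E) < d * (1 + E) by rewrite ltr_pM2r // ltr_wpDr.
move: pd_ge0; rewrite pdE e1 e2.
nra.
Qed.

End Numeric.

(** * Separation of the zeros *)

(** At a zero [hat_residual] and f_n vanish, and the pure powers of t reduce to
    t^mu; dividing [eliminated_bound] by s^mu then gives the opposite of
    [angular_inequality]. *)
Lemma no_zero_nearby (R : realType) (n mu : nat) (f : system R n n.+1)
    (x w : 'cV[R[i]]_n.+1) (mu2 : (2 <= mu)%N) (hnf : normalized_form f x)
    (hx : simple_multiple_zero f x mu) (hy : is_zero f (x + w)) :
  2 * gamma f x mu ^+ mu * hnorm w < dconst R mu -> w = 0.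
Proof.
set g := gamma f x mu; set s := hnorm w; set d := dconst R mu => sd.
have fx : is_zero f x by case: hx.
have g1 : 1 <= g := gamma_ge1 f x mu; have g0 : 0 <= g := gamma_ge0 f x mu.
have [dd1 dd2 dd3 pd0] := dconst_le R mu2; have d0 := dconst_gt0 R mu2.
apply: contrapT => w0.
have s0 : 0 < s.
  rewrite lt_neqAle hnorm_ge0 andbT eq_sym; apply/eqP => /hnorm_eq0; exact: w0.
have d1 : d <= 1.
  by rewrite -(@ler_sqr _ d 1) ?nnegrE ?(ltW d0) // expr1n (d_le1 mu2 d0 dd2).
have gmu : g ^+ mu = g ^+ mu.-1 * g by rewrite -exprSr prednK // ltnW.
have G1 : 1 <= g ^+ mu.-1 by rewrite exprn_ege1.
have gs : g * s <= 1 / 2.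
  have : g * s <= g ^+ mu * s.
    by rewrite ler_pM2r // gmu ler_peMl.
  by move: sd d1; rewrite -mulrA; move: (g * s) (g ^+ mu * s) => *; lra.
have residual0 : hat_residual f x w = 0.
  rewrite /hat_residual (_ : (\col_i _) = 0) ?mulmx0 //.
  by apply/matrixP => i j; rewrite !mxE; exact: hy.
have hat_part_le : hnorm (hat_part w) <= 2 * (g * s ^+ 2).
  pose N := (2 + \sum_i msize (f i))%N.
  have fN i : (msize (f i) <= N)%N.
    by rewrite /N (bigD1 i) //= addnCA leq_addr.
  have := hat_residualE hnf fx w fN (leq_addr _ _).
  rewrite residual0 => /esym/eqP; rewrite addr_eq0 => /eqP ->.
  rewrite hnorm_opp; exact: (hat_form_remainder N gs (ltnSn 1)).
have [T0 T1] := elim_form_on_axis mu2 hnf hx.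
have := eliminated_bound mu2 hnf fx gs; rewrite /= -/g -/s.
rewrite [evalp _ _](hy ord_max) mulr0 subr0 residual0 hnorm0.
rewrite big_nat_recr //= T1 mulr1 big_nat big1 => [|k k2]; last by rewrite T0 ?mulr0.
rewrite add0r normcX; set t := Normc.normc _; set v := hnorm (hat_part w).
have sn0 : s != 0 by rewrite gt_eqF.
(* Cosine and sine of the angle between w and the first axis. *)
have [ct [cv [tE vE]]] : exists ct cv, t = ct * s /\ v = cv * s.
  by exists (t / s), (v / s); rewrite !divfK.
have t0 : 0 <= t := normc_ge0 _; have v0 : 0 <= v := hnorm_ge0 _.
have ct0 : 0 <= ct by move: t0; rewrite tE pmulr_lge0.
have cv0 : 0 <= cv by move: v0; rewrite vE pmulr_lge0.
have unit_norm : ct ^+ 2 + cv ^+ 2 = 1.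
  apply: (mulIf (expf_neq0 2 sn0)); rewrite mul1r mulrDl -!exprMn -tE -vE.
  by rewrite -hnorm_sqr_hat_part.
pose delta := 2 * g ^+ mu * s.
have cv_small : g ^+ mu.-1 * cv <= delta.
  rewrite /delta gmu -(ler_pM2r s0) -[X in X <= _]mulrA -vE.
  have -> : 2 * (g ^+ mu.-1 * g) * s * s = g ^+ mu.-1 * (2 * (g * s ^+ 2)) by ring.
  by apply: ler_wpM2l; rewrite ?exprn_ge0.
have gap := angular_inequality mu2 d0 dd1 dd2 pd0 ct0 cv0 unit_norm G1 cv_small sd.
apply/negP; rewrite -ltNge.
move: gap; rewrite -(ltr_pM2l (exprn_gt0 mu s0)).
rewrite [_ * ct ^+ mu]mulrC -exprMn -tE; apply: le_lt_trans.
rewrite le_eqVlt; apply/orP; left; apply/eqP.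
rewrite mulrDr -addrA; congr (_ + _).
  rewrite mulr_sumr !big_nat; apply: eq_bigr => j /andP[_ jmu].
  rewrite tE vE !exprMn.
  have -> : s ^+ mu = s ^+ (mu - j) * s ^+ j by rewrite -exprD subnK.
  by ring.
rewrite mulrDr mulr1 mulrDr; congr (_ + _); first by rewrite /delta exprS; ring.
rewrite !mulr_sumr; apply: eq_bigr => i _; rewrite !mulr_sumr; apply: eq_bigr => j /andP[ij1 ij2].
rewrite mulr0 add0r tE vE !exprMn /delta exprS.
have -> : s ^+ mu = s ^+ (mu - (i + j)) * (s ^+ i * s ^+ j).
  by rewrite -!exprD subnK //; move: ij2; clear; lia.
by ring.
Qed.

(* The dimension of the ambient space is n.+1. *)
Theorem theorem5 (R : realType) (n mu : nat) (hn : (2 <= n.+1)%N)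
    (hmu : (2 <= mu)%N) (f : system R n n.+1) (x y : 'cV[R[i]]_n.+1)
    (hnf : normalized_form f x) (hx : simple_multiple_zero f x mu)
    (hyx : y <> x) (hy : is_zero f y) :
  0 < dconst R mu /\
  dconst R mu / (2 * gamma f x mu ^+ mu) <= hnorm (y - x).
Proof.
split; first exact: dconst_gt0.
have g0 : 0 < 2 * gamma f x mu ^+ mu.
  by rewrite mulr_gt0 // exprn_gt0 // (lt_le_trans ltr01) // gamma_ge1.
rewrite ler_pdivrMr // mulrC leNgt; apply/negP => lt_d; apply: hyx.
by apply/subr0_eq; apply: no_zero_nearby lt_d => //; rewrite addrC subrK.
Qed.
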